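(* Let $y\in WH_b$. Then there is a unique element $C_y\in\widetilde{\mathcal H}$ such that (1) $\overline{C_y}=C_y$ and (2) $C_y\equiv T_y \bmod \widetilde{\mathcal H}_{<0}$.
   Context: Let $q$ be a prime power, $n\ge1$, and $a,b$ relatively prime positive integers with $ab=q-1$. Let $F_b$ be the subgroup of order $b$ of $\mathbb F_q^\times$, $H_b$ the group of diagonal matrices in $\mathrm{GL}_n(\mathbb F_q)$ with entries in $F_b$, and $W\subset\mathrm{GL}_n(\mathbb F_q)$ the group of permutation matrices, so $WH_b$ is a subgroup isomorphic to $G(b,1,n)$. $\mathcal S=\{s_1,\dots,s_{n-1}\}$, where $s_i$ is the permutation matrix of $(i,i+1)$; $\ell$ is the length function of $(W,\mathcal S)$, extended to $WH_b$ by $\ell(wd)=\ell(dw)=\ell(w)$ for $w\in W$, $d\in H_b$. For $\alpha\in F_b$, $h_i(\alpha)$ is the diagonal matrix with $i$-th diagonal entry $\alpha$ and other diagonal entries $1$; $h_{i,j}(\alpha)=h_i(\alpha)h_j((-1)^{b-1}\alpha^{-1})$ for $i\ne j$; and $X_{s_i}=\{h_{i,i+1}(\alpha)\mid\alpha\in F_b\}$. Let $A=\mathbb Z[\mathbf a,\mathbf v]$ with $\mathbf a,\mathbf v$ indeterminates. $\mathcal H$ is the associative unital $A$-algebra with generators $\{t_s\mid s\in\mathcal S\}\cup\{t_d\mid d\in H_b\}$ and relations: $t_1=1_{\mathcal H}$; $t_dt_{d'}=t_{dd'}$; $t_dt_{s_i}=t_{s_i}t_{s_ids_i}$; $t_{s_i}t_{s_j}=t_{s_j}t_{s_i}$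 if $|j-i|>1$; $t_{s_i}t_{s_{i+1}}t_{s_i}=t_{s_{i+1}}t_{s_i}t_{s_{i+1}}$; $t_{s_i}^2=\mathbf v^2 1_{\mathcal H}+\mathbf a\sum_{d\in X_{s_i}}t_dt_{s_i}$. For $x=wd$ with $w=s_{i_1}\cdots s_{i_p}\in W$ reduced and $d\in H_b$, $t_x=t_{s_{i_1}}\cdots t_{s_{i_p}}t_d$ (well defined); $\{t_x\}_{x\in WH_b}$ is an $A$-basis of $\mathcal H$. Let $\mathbb Z_b=\mathbb Z[1/b]$ and $\widetilde A=\mathbb Z_b[\mathbf v,\mathbf v^{-1}]$, regarded as an $A$-algebra via $\mathbf v\mapsto\mathbf v$, $\mathbf a\mapsto(\mathbf v^2-1)/b$ (equivalently $\widetilde A=\mathbb Z_b[\mathbf a,\mathbf v,\mathbf v^{-1}]/(b\mathbf a-(\mathbf v^2-1))$). Let $\widetilde{\mathcal H}=\widetilde A\otimes_A\mathcal H$ and $T_x=\mathbf v^{-\ell(x)}\otimes t_x$; $\{T_x\}_{x\in WH_b}$ is an $\widetilde A$-basis of $\widetilde{\mathcal H}$ and each $T_x$ is a unit. The bar involution on $\widetilde A$ is the $\mathbb Z_b$-algebra automorphism with $\overline{\mathbf v}=\mathbf v^{-1}$, and on $\widetilde{\mathcal H}$ it is $\overline{\sum_x\gamma_xT_x}=\sum_x\overline{\gamma_x}\,T_{x^{-1}}^{-1}$. Set $\widetilde A_{<0}=\mathbf v^{-1}\mathbb Z_b[\mathbf v^{-1}]$ and $\widetilde{\mathcal H}_{<0}=\bigoplus_{x\in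 WH_b}\widetilde A_{<0}T_x$. *)

(* Defs.v *)
From HB Require Import structures.
From mathcomp Require Import all_boot all_order all_algebra all_fingroup.
From mathcomp Require Import generic_quotient.
From mathcomp Require Import boolp classical_sets.

Set Implicit Arguments.
Unset Strict Implicit.
Unset Printing Implicit Defensive.

Import GRing.Theory Num.Theory.
Local Open Scope ring_scope.
Local Open Scope quotient_scope.

(** [palg rels] is the associative unital [R]-algebra generated by [X] subject
    to [rels]: formal expressions modulo the least congruence that contains
    [rels] and satisfies the [R]-algebra axioms.  MathComp's [algType] requires
    [1 != 0], which fails for some presentations, so [palg rels] is only
    declared as a [pzRingType] and an [lmodType R]; [palg_scalerAl] and
    [palg_scalerAr] are the remaining algebra axioms. *)

Section Presentation.
Variables (R : comNzRingType) (X : Type).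

Inductive term : Type :=
| Gen of X
| Zero
| One
| Opp of term
| Add of term & term
| Mul of term & term
| Scale of R & term.

HB.instance Definition _ := gen_eqMixin term.
HB.instance Definition _ := gen_choiceMixin term.

Variable rels : term -> term -> Prop.

Inductive cong : term -> term -> Prop :=
| cong_rel t u : rels t u -> cong t u
| cong_refl t : cong t t
| cong_sym t u : cong t u -> cong u t
| cong_trans t u w : cong t u -> cong u w -> cong t w
| cong_opp t t' : cong t t' -> cong (Opp t) (Opp t')
| cong_add t t' u u' :
    cong t t' -> cong u u' -> cong (Add t u) (Add t' u')
| cong_mul t t' u u' :
    cong t t' -> cong u u' -> cong (Mul t u) (Mul t' u')
| cong_scale r t t' : cong t t' -> cong (Scale r t) (Scale r t')
| cong_addA t u w : cong (Add t (Add u w)) (Add (Add t u) w)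
| cong_addC t u : cong (Add t u) (Add u t)
| cong_add0 t : cong (Add Zero t) t
| cong_addN t : cong (Add (Opp t) t) Zero
| cong_mulA t u w : cong (Mul t (Mul u w)) (Mul (Mul t u) w)
| cong_mul1l t : cong (Mul One t) t
| cong_mul1r t : cong (Mul t One) t
| cong_mulDl t u w : cong (Mul (Add t u) w) (Add (Mul t w) (Mul u w))
| cong_mulDr t u w : cong (Mul t (Add u w)) (Add (Mul t u) (Mul t w))
| cong_scaleA r s t : cong (Scale r (Scale s t)) (Scale (r * s) t)
| cong_scale1 t : cong (Scale 1 t) t
| cong_scaleDr r t u : cong (Scale r (Add t u)) (Add (Scale r t) (Scale r u))
| cong_scaleDl r s t : cong (Scale (r + s) t) (Add (Scale r t) (Scale s t))
| cong_scaleAl r t u : cong (Scale r (Mul t u)) (Mul (Scale r t) u)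
| cong_scaleAr r t u : cong (Scale r (Mul t u)) (Mul t (Scale r u)).

Definition congb : rel term := fun t u => `[< cong t u >].

Lemma congb_refl : reflexive congb.
Proof. by move=> t; apply/asboolP; apply: cong_refl. Qed.

Lemma congb_sym : symmetric congb.
Proof. by move=> t u; apply/asboolP/asboolP; apply: cong_sym. Qed.

Lemma congb_trans : transitive congb.
Proof.
by move=> u t w /asboolP tu /asboolP uw; apply/asboolP; apply: cong_trans uw.
Qed.

Canonical congb_equiv := EquivRel congb congb_refl congb_sym congb_trans.

Definition palg : Type := {eq_quot congb}.

HB.instance Definition _ := Choice.on palg.

Definition palg_pi (t : term) : palg := \pi_{eq_quot congb} t.
Definition palg_repr (x : palg) : term := repr (x : {eq_quot congb}).

Lemma palg_reprK x : palg_pi (palg_repr x) = x.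
Proof. exact: reprK. Qed.

Lemma palg_piE t u : palg_pi t = palg_pi u <-> cong t u.
Proof.
by split=> [/eqquotP/asboolP //|tu]; apply/eqquotP; apply/asboolP.
Qed.

Lemma palg_piK t : cong (palg_repr (palg_pi t)) t.
Proof. by apply/palg_piE; rewrite palg_reprK. Qed.

Definition palg_zero := palg_pi Zero.
Definition palg_one := palg_pi One.
Definition palg_opp x := palg_pi (Opp (palg_repr x)).
Definition palg_add x y := palg_pi (Add (palg_repr x) (palg_repr y)).
Definition palg_mul x y := palg_pi (Mul (palg_repr x) (palg_repr y)).
Definition palg_scale r x := palg_pi (Scale r (palg_repr x)).

Lemma palg_piN t : palg_opp (palg_pi t) = palg_pi (Opp t).
Proof. by apply/palg_piE; apply: cong_opp; apply: palg_piK. Qed.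

Lemma palg_piD t u : palg_add (palg_pi t) (palg_pi u) = palg_pi (Add t u).
Proof. by apply/palg_piE; apply: cong_add; apply: palg_piK. Qed.

Lemma palg_piM t u : palg_mul (palg_pi t) (palg_pi u) = palg_pi (Mul t u).
Proof. by apply/palg_piE; apply: cong_mul; apply: palg_piK. Qed.

Lemma palg_piZ r t : palg_scale r (palg_pi t) = palg_pi (Scale r t).
Proof. by apply/palg_piE; apply: cong_scale; apply: palg_piK. Qed.

Let piE := (palg_piN, palg_piD, palg_piM, palg_piZ).

Local Lemma palg_ind (P : palg -> Prop) : (forall t, P (palg_pi t)) -> forall x, P x.
Proof. by move=> Pt x; rewrite -(palg_reprK x). Qed.

Lemma palg_addA : associative palg_add.
Proof.
elim/palg_ind=> t; elim/palg_ind=> u; elim/palg_ind=> w.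
by rewrite !piE; apply/palg_piE; apply: cong_addA.
Qed.

Lemma palg_addC : commutative palg_add.
Proof.
elim/palg_ind=> t; elim/palg_ind=> u.
by rewrite !piE; apply/palg_piE; apply: cong_addC.
Qed.

Lemma palg_add0 : left_id palg_zero palg_add.
Proof.
by elim/palg_ind=> t; rewrite !piE; apply/palg_piE; apply: cong_add0.
Qed.

Lemma palg_addN : left_inverse palg_zero palg_opp palg_add.
Proof.
by elim/palg_ind=> t; rewrite !piE; apply/palg_piE; apply: cong_addN.
Qed.

HB.instance Definition _ :=
  GRing.isZmodule.Build palg palg_addA palg_addC palg_add0 palg_addN.

Lemma palg_mulA : associative palg_mul.
Proof.
elim/palg_ind=> t; elim/palg_ind=> u; elim/palg_ind=> w.
by rewrite !piE; apply/palg_piE; apply: cong_mulA.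
Qed.

Lemma palg_mul1l : left_id palg_one palg_mul.
Proof.
by elim/palg_ind=> t; rewrite !piE; apply/palg_piE; apply: cong_mul1l.
Qed.

Lemma palg_mul1r : right_id palg_one palg_mul.
Proof.
by elim/palg_ind=> t; rewrite !piE; apply/palg_piE; apply: cong_mul1r.
Qed.

Lemma palg_mulDl : left_distributive palg_mul palg_add.
Proof.
elim/palg_ind=> t; elim/palg_ind=> u; elim/palg_ind=> w.
by rewrite !piE; apply/palg_piE; apply: cong_mulDl.
Qed.

Lemma palg_mulDr : right_distributive palg_mul palg_add.
Proof.
elim/palg_ind=> t; elim/palg_ind=> u; elim/palg_ind=> w.
by rewrite !piE; apply/palg_piE; apply: cong_mulDr.
Qed.

HB.instance Definition _ := GRing.Zmodule_isPzRing.Build palg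
  palg_mulA palg_mul1l palg_mul1r palg_mulDl palg_mulDr.

Lemma palg_scaleA r s x : palg_scale r (palg_scale s x) = palg_scale (r * s) x.
Proof.
by elim/palg_ind: x => t; rewrite !piE; apply/palg_piE; apply: cong_scaleA.
Qed.

Lemma palg_scale1 : left_id 1 palg_scale.
Proof.
by elim/palg_ind=> t; rewrite !piE; apply/palg_piE; apply: cong_scale1.
Qed.

Lemma palg_scaleDr : right_distributive palg_scale +%R.
Proof.
move=> r; elim/palg_ind=> t; elim/palg_ind=> u; rewrite /GRing.add /= !piE.
by apply/palg_piE; apply: cong_scaleDr.
Qed.

Lemma palg_scaleDl x : {morph palg_scale^~ x : r s / r + s}.
Proof.
move=> r s; elim/palg_ind: x => t; rewrite {2}/GRing.add /= !piE.
by apply/palg_piE; apply: cong_scaleDl.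
Qed.

HB.instance Definition _ := GRing.Zmodule_isLmodule.Build R palg
  palg_scaleA palg_scale1 palg_scaleDr palg_scaleDl.

Lemma palg_scalerAl (r : R) (x y : palg) : r *: (x * y) = (r *: x) * y.
Proof.
elim/palg_ind: x => t; elim/palg_ind: y => u.
rewrite /GRing.scale /GRing.mul /= !piE.
by apply/palg_piE; apply: cong_scaleAl.
Qed.

Lemma palg_scalerAr (r : R) (x y : palg) : r *: (x * y) = x * (r *: y).
Proof.
elim/palg_ind: x => t; elim/palg_ind: y => u.
rewrite /GRing.scale /GRing.mul /= !piE.
by apply/palg_piE; apply: cong_scaleAr.
Qed.

Definition palg_gen (x : X) : palg := palg_pi (Gen x).

End Presentation.

Arguments Gen {R X}.
Arguments Zero {R X}.
Arguments One {R X}.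

(** For [phi : A -> B] and an [A]-algebra [H], [B (x)_A H] is generated as a
    [B]-algebra by the symbols [beta (x) h], subject to bilinearity, to
    [(beta * phi r) (x) h = beta (x) (r *: h)], and to the usual formulas for
    the action of [B], the product and the unit. *)

Section ExtensionOfScalars.
Variables (A B : comNzRingType) (phi : A -> B).
Variables (X : Type) (rels : term A X -> term A X -> Prop).
Let H := palg rels.

Inductive tensor_rels : term B (B * H) -> term B (B * H) -> Prop :=
| tensor_Dl (c c' : B) (h : H) :
    tensor_rels (Gen (c + c', h)) (Add (Gen (c, h)) (Gen (c', h)))
| tensor_Dr (c : B) (h h' : H) :
    tensor_rels (Gen (c, h + h')) (Add (Gen (c, h)) (Gen (c, h')))
| tensor_balanced (c : B) (r : A) (h : H) :
    tensor_rels (Gen (c * phi r, h)) (Gen (c, r *: h))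
| tensor_scale (c c' : B) (h : H) :
    tensor_rels (Scale c (Gen (c', h))) (Gen (c * c', h))
| tensor_mul (c c' : B) (h h' : H) :
    tensor_rels (Mul (Gen (c, h)) (Gen (c', h'))) (Gen (c * c', h * h'))
| tensor_one : tensor_rels One (Gen (1, 1)).

Definition tensor_palg := palg tensor_rels.

HB.instance Definition _ := Choice.on tensor_palg.
HB.instance Definition _ := GRing.PzRing.on tensor_palg.
HB.instance Definition _ := GRing.Lmodule.on tensor_palg.

Definition tensor (c : B) (h : H) : tensor_palg :=
  palg_gen tensor_rels (c, h).

End ExtensionOfScalars.

Definition Qv : Type := {fraction {poly rat}}.
HB.instance Definition _ := GRing.Field.on Qv.

Definition vQ : Qv := FracField.tofrac 'X.
Definition cQ : {rmorphism rat -> Qv} :=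
  [the {rmorphism rat -> Qv} of @FracField.tofrac {poly rat} \o polyC].

(* p(1/v) *)
Definition evalV (p : {poly rat}) : Qv := (map_poly cQ p).[vQ^-1].

(* The automorphism f(v) |-> f(1/v) of Q(v), on the numerator and denominator
   of a representative of f. *)
Definition barQ (f : Qv) : Qv := evalV (\n_(repr f)) / evalV (\d_(repr f)).

Lemma vQ_neq0 : vQ != 0.
Proof. by rewrite /vQ tofrac_eq0 polyX_eq0. Qed.

Lemma evalVM p q : evalV (p * q) = evalV p * evalV q.
Proof. by rewrite /evalV rmorphM hornerM. Qed.

Lemma evalVXn k : evalV 'X^k = vQ ^- k.
Proof. by rewrite /evalV map_polyXn hornerXn exprVn. Qed.

Lemma tofrac_horner (p : {poly rat}) :
  FracField.tofrac p = (map_poly cQ p).[vQ] :> Qv.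
Proof.
elim/poly_ind: p => [|p c IHp]; first by rewrite rmorph0 map_poly0 horner0.
rewrite tofracD tofracM IHp rmorphD rmorphM /= map_polyX map_polyC.
by rewrite hornerD hornerMX hornerC.
Qed.

Definition revp (n : nat) (p : {poly rat}) : {poly rat} :=
  \poly_(i < n.+1) p`_(n - i).

Lemma evalV_revp (n : nat) (p : {poly rat}) :
  (size p <= n.+1)%N -> evalV p = FracField.tofrac (revp n p) / vQ ^+ n.
Proof.
move=> sz_p; rewrite /evalV tofrac_horner.
rewrite (@horner_coef_wide _ n.+1) ?size_map_poly //.
rewrite (@horner_coef_wide _ n.+1) ?size_map_poly ?size_poly //.
rewrite (reindex_inj rev_ord_inj) /= mulr_suml; apply: eq_bigr => i _.
rewrite !coef_map coef_poly ltn_ord subSS exprVn -mulrA; congr (_ * _).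
have le_in : (i <= n)%N by rewrite -ltnS.
rewrite -[X in _ = _ / vQ ^+ X](subnK le_in) exprD invfM mulrCA divff ?mulr1 //.
by rewrite expf_neq0 // vQ_neq0.
Qed.

Lemma evalV_eq0 p : (evalV p == 0) = (p == 0).
Proof.
apply/eqP/eqP => [|->]; last by rewrite /evalV map_poly0 horner0.
rewrite (@evalV_revp (size p)) // => /eqP.
rewrite mulf_eq0 invr_eq0 expf_eq0 (negbTE vQ_neq0) andbF orbF tofrac_eq0.
move=> /eqP rev0; apply/polyP => i; rewrite coef0.
have [le_pi|lt_ip] := leqP (size p) i; first by rewrite nth_default.
have := congr1 (fun r : {poly rat} => r`_(size p - i)) rev0.
by rewrite coef0 coef_poly ltnS leq_subr subKn // ltnW.
Qed.

Lemma tofrac_numden (f : Qv) :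
  f * FracField.tofrac (\d_(repr f)) = FracField.tofrac (\n_(repr f)).
Proof.
rewrite -{1}[f]reprK; unlock FracField.tofrac.
rewrite -[LHS]FracField.pi_mul; apply/eqmodP.
rewrite /= FracField.equivfE /FracField.mulf !numden_Ratio ?oner_neq0 //.
  by rewrite !mulr1 mulrC.
all: by rewrite mulr1 denom_ratioP.
Qed.

Lemma barQE p q : q != 0 ->
  barQ (FracField.tofrac p / FracField.tofrac q) = evalV p / evalV q.
Proof.
move=> q_neq0; rewrite /barQ; set f := (X in repr X).
have := tofrac_numden f; set d := \d_(repr f); set n := \n_(repr f) => fd.
have d_neq0 : d != 0 by rewrite denom_ratioP.
apply/eqP; rewrite eqr_div ?evalV_eq0 // -!evalVM; apply/eqP; congr evalV.
apply/eqP; rewrite -tofrac_eq !tofracM -fd /f mulrAC.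
by rewrite divfK ?tofrac_eq0.
Qed.

Section Coefficients.
Variable b : nat.

(* Z[1/b] *)
Definition Zb : {pred rat} :=
  fun r => `[< exists k : nat, r * b%:R ^+ k \is a Num.int >].

(* Z[1/b][v, 1/v] inside Q(v) *)
Definition laurent : {pred Qv} :=
  fun f => `[< exists (p : {poly rat}) (k : nat),
    p \is a polyOver Zb /\ f = FracField.tofrac p / vQ ^+ k >].

Lemma Zb_subring : subring_closed Zb.
Proof.
split.
- by apply/asboolP; exists 0%N; rewrite mulr1.
- move=> x y /asboolP[k xk] /asboolP[l yl]; apply/asboolP; exists (k + l)%N.
  rewrite mulrBl {1}exprD [_ ^+ (k + l)]exprD mulrA [_ ^+ k * _]mulrC mulrA.
  by rewrite rpredB // rpredM // rpredX // intr_nat.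
- move=> x y /asboolP[k xk] /asboolP[l yl]; apply/asboolP; exists (k + l)%N.
  by rewrite exprD mulrACA rpredM.
Qed.

HB.instance Definition _ := GRing.isSubringClosed.Build rat Zb Zb_subring.

Lemma Zb_invb : b%:R^-1 \in Zb.
Proof.
apply/asboolP; exists 1%N; rewrite expr1.
have [->|b0] := eqVneq (b%:R : rat) 0; first by rewrite mulr0.
by rewrite mulVf.
Qed.

Lemma laurent_poly p : p \is a polyOver Zb -> FracField.tofrac p \in laurent.
Proof. by move=> pZ; apply/asboolP; exists p, 0%N; rewrite divr1. Qed.

Lemma laurent_vinv : vQ^-1 \in laurent.
Proof.
by apply/asboolP; exists 1, 1%N; rewrite rpred1 tofrac1 expr1 div1r.
Qed.

Lemma laurent_v : vQ \in laurent.
Proof. by apply: laurent_poly; rewrite polyOverX. Qed.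

Lemma laurent_invb : FracField.tofrac (b%:R^-1)%:P \in laurent.
Proof. by apply: laurent_poly; rewrite polyOverC Zb_invb. Qed.

Lemma laurent_subring : subring_closed laurent.
Proof.
have vN0 k : vQ ^+ k != 0 by rewrite expf_neq0 // vQ_neq0.
split.
- by rewrite -tofrac1; apply: laurent_poly; rewrite rpred1.
- move=> f g /asboolP[p [k [pZ ->]]] /asboolP[q [l [qZ ->]]].
  apply/asboolP; exists (p * 'X^l - q * 'X^k), (k + l)%N; split.
    by rewrite rpredB // rpredM // polyOverXn.
  by rewrite tofracB !tofracM !tofracXn -/vQ exprD -mulNr addf_div // mulNr.
- move=> f g /asboolP[p [k [pZ ->]]] /asboolP[q [l [qZ ->]]].
  apply/asboolP; exists (p * q), (k + l)%N; split; first by rewrite rpredM.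
  by rewrite tofracM exprD invfM mulrACA.
Qed.

HB.instance Definition _ := GRing.isSubringClosed.Build Qv laurent laurent_subring.

Record Atilde : Type := MkAtilde { Atilde_val : Qv; _ : Atilde_val \in laurent }.
HB.instance Definition _ := [isSub for Atilde_val].
HB.instance Definition _ := [Choice of Atilde by <:].
HB.instance Definition _ := [SubChoice_isSubComNzRing of Atilde by <:].

Lemma barQ_laurent f : f \in laurent -> barQ f \in laurent.
Proof.
move=> /asboolP[p [k [pZ ->]]].
rewrite -tofracXn barQE ?expf_neq0 ?polyX_eq0 //.
rewrite evalVXn invrK (@evalV_revp (size p)) //.
apply/asboolP; exists (revp (size p) p * 'X^k), (size p).
split; last by rewrite tofracM tofracXn mulrAC.
rewrite rpredM ?polyOverXn //; apply/polyOverP => i; rewrite coef_poly.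
by case: ifP => _; [apply: (polyOverP pZ) | rewrite rpred0].
Qed.

(* the Z[1/b]-algebra automorphism v |-> 1/v *)
Definition Abar (f : Atilde) : Atilde := MkAtilde (barQ_laurent (valP f)).

Definition Av : Atilde := MkAtilde laurent_v.
Definition Avinv : Atilde := MkAtilde laurent_vinv.
Definition Ainvb : Atilde := MkAtilde laurent_invb.

(* v^-1 Z[1/b][v^-1] *)
Definition Aneg : Atilde -> Prop := fun f =>
  exists p : {poly rat}, p \is a polyOver Zb /\ val f = vQ^-1 * evalV p.

(* A = Z[a, v], with a = ('X)%:P and v = 'X, and the ring morphism A -> Atilde
   that sends v to v and a to (v^2 - 1)/b *)
Definition specialize (p : {poly {poly int}}) : Atilde :=
  (map_poly (fun r : {poly int} =>
     (map_poly intr r).[Ainvb * (Av ^+ 2 - 1)]) p).[Av].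

End Coefficients.

(* Throughout, n = m.+1. *)
Section MonomialGroup.
Variables (F : finFieldType) (m b : nat) (Fb : {group {unit F}}).
Local Notation GL := {'GL_m.+1[F]}.

Lemma diag_unit (f : {ffun 'I_m.+1 -> {unit F}}) :
  diag_mx (\row_i val (f i)) \is a @GRing.unit 'M[F]_m.+1.
Proof.
change (diag_mx (\row_i val (f i)) \in unitmx).
rewrite unitmxE det_diag rpred_prod // => i _.
by rewrite mxE (valP (f i)).
Qed.

Definition diagGL (f : {ffun 'I_m.+1 -> {unit F}}) : GL :=
  FinRing.unit _ (diag_unit f).

Lemma tperm_unit (i j : 'I_m.+1) :
  tperm_mx i j \is a @GRing.unit 'M[F]_m.+1.
Proof. exact: unitmx_perm. Qed.

(* With 0-based indices, [sgen i] exchanges the coordinates i and i.+1. *)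
Definition sgen (i : 'I_m) : GL :=
  FinRing.unit _ (tperm_unit (widen_ord (leqnSn m) i) (lift ord0 i)).

Definition Wperm : {set GL} := [set g : GL | is_perm_mx (GLval g)].

Definition Hdiag : {set GL} := [set diagGL f | f in ffun_on (mem Fb)].

Lemma Hdiag_group_set : group_set Hdiag.
Proof.
apply/group_setP; split=> [|x y].
  apply/imsetP; exists [ffun=> 1%g].
    by apply/ffun_onP => i; rewrite ffunE group1.
  by apply: val_inj; apply/matrixP => i j; rewrite !mxE ffunE.
case/imsetP=> f /ffun_onP Ff ->; case/imsetP=> g /ffun_onP Fg ->.
apply/imsetP; exists [ffun i => (f i * g i)%g].
  by apply/ffun_onP => i; rewrite ffunE groupM ?Ff ?Fg.
apply: val_inj; rewrite /= -[LHS]/(_ *m _) mulmx_diag; congr diag_mx.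
by apply/rowP => i; rewrite !mxE ffunE.
Qed.
Canonical Hdiag_group := Group Hdiag_group_set.

Definition WHb : {set GL} := (Wperm * Hdiag)%g.

(* h_i(alpha), h_{i,j}(alpha) and X_{s_i} *)
Definition hone (i : 'I_m.+1) (alpha : {unit F}) : GL :=
  diagGL [ffun k => if k == i then alpha else 1%g].

Definition m1F : {unit F} := FinRing.unit F (unitrN1 F).

Definition htwo (i j : 'I_m.+1) (alpha : {unit F}) : GL :=
  (hone i alpha * hone j (m1F ^+ b.-1 * alpha^-1))%g.

Definition Xs (i : 'I_m) : {set GL} :=
  [set htwo (widen_ord (leqnSn m) i) (lift ord0 i) alpha | alpha in Fb].

Definition word (t : seq 'I_m) : GL := (\prod_(i <- t) sgen i)%g.

(* The least p such that w is a product of p elements of S; the bound #|GL| on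
   the search is harmless, since a shortest word has distinct prefixes. *)
Definition lenW (w : GL) : nat :=
  find (fun p => [exists t : p.-tuple 'I_m, word t == w]) (iota 0 #|{: GL}|).

(* Some reduced word of w; which one does not matter for [tx] below, by the
   braid relations. *)
Definition redword (w : GL) : seq 'I_m :=
  if [pick t : (lenW w).-tuple 'I_m | word t == w] is Some t then t else [::].

(* The factors of x = w d, which are unique since W and H_b meet trivially. *)
Definition wpart (x : GL) : GL :=
  odflt 1%g [pick w in Wperm | (w^-1 * x)%g \in Hdiag].
Definition dpart (x : GL) : GL := ((wpart x)^-1 * x)%g.

Definition len (x : GL) : nat := lenW (wpart x).

End MonomialGroup.

Section Hecke.
Variables (F : finFieldType) (m b : nat) (Fb : {group {unit F}}).
Local Notation GL := {'GL_m.+1[F]}.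
Local Notation Hd := (Hdiag m Fb).
Local Notation HdG := (Hdiag_group m Fb).
Local Notation s_ := (@sgen F m).

Local Notation A := {poly {poly int}}.
Local Notation aA := (('X : {poly int})%:P : A).
Local Notation vA := ('X : A).

Local Notation gens := ('I_m + subg_of HdG)%type.
Local Notation gs i := (Gen (inl i) : term A gens).
(* [subg] retracts GL onto H_b; it is only applied to elements of H_b. *)
Local Notation gd d := (Gen (inr (subg HdG d)) : term A gens).

Inductive hecke_rels : term A gens -> term A gens -> Prop :=
| hecke_1 : hecke_rels (gd 1%g) One
| hecke_dd d d' : d \in Hd -> d' \in Hd ->
    hecke_rels (Mul (gd d) (gd d')) (gd (d * d')%g)
| hecke_ds d i : d \in Hd ->
    hecke_rels (Mul (gd d) (gs i)) (Mul (gs i) (gd (s_ i * d * s_ i)%g))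
| hecke_comm (i j : 'I_m) : (i.+1 < j)%N || (j.+1 < i)%N ->
    hecke_rels (Mul (gs i) (gs j)) (Mul (gs j) (gs i))
| hecke_braid (i j : 'I_m) : j = i.+1 :> nat ->
    hecke_rels (Mul (Mul (gs i) (gs j)) (gs i)) (Mul (Mul (gs j) (gs i)) (gs j))
| hecke_quad i :
    hecke_rels (Mul (gs i) (gs i))
      (Add (Scale (vA ^+ 2) One)
           (Scale aA (\big[@Add A gens/Zero]_(d in Xs b Fb i)
                        Mul (gd d) (gs i)))).

Definition hecke := palg hecke_rels.
HB.instance Definition _ := Choice.on hecke.
HB.instance Definition _ := GRing.PzRing.on hecke.
HB.instance Definition _ := GRing.Lmodule.on hecke.

Definition ts (i : 'I_m) : hecke := palg_gen hecke_rels (inl i).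
Definition td (d : GL) : hecke := palg_gen hecke_rels (inr (subg HdG d)).

Definition tx (x : GL) : hecke :=
  (\prod_(i <- redword (wpart Fb x)) ts i) * td (dpart Fb x).

Definition heckeT := tensor_palg (@specialize b) hecke_rels.
HB.instance Definition _ := Choice.on heckeT.
HB.instance Definition _ := GRing.PzRing.on heckeT.
HB.instance Definition _ := GRing.Lmodule.on heckeT.

Definition Tx (x : GL) : heckeT :=
  tensor (@specialize b) (Avinv b ^+ len Fb x) (tx x : palg hecke_rels).

(* The two-sided inverse, and 0 where there is none. *)
Definition hinv (h : heckeT) : heckeT :=
  xget 0 (fun u : heckeT => u * h = 1 /\ h * u = 1).

(* Coordinates in the basis (T_x), x in W H_b; values outside W H_b are
   arbitrary and never used. *)
Definition coord (h : heckeT) : {ffun GL -> Atilde b} :=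
  xget 0 (fun c : {ffun GL -> Atilde b} =>
    h = \sum_(x in WHb m Fb) c x *: Tx x).

Definition hbar (h : heckeT) : heckeT :=
  \sum_(x in WHb m Fb) Abar (coord h x) *: hinv (Tx x^-1%g).

(* Membership in the direct sum of the Aneg T_x, x in W H_b. *)
Definition heckeT_neg (h : heckeT) : Prop :=
  exists c : GL -> Atilde b,
    (forall x, x \in WHb m Fb -> Aneg (c x)) /\
    h = \sum_(x in WHb m Fb) c x *: Tx x.

End Hecke.

(* Main.v *)
(** Write S for the Hecke algebra over Atilde and c = (v - 1/v)/b, so that
    T_s^2 = 1 + c E_s T_s with E_s the sum of the T_d over d in X_s, and
    T_s^-1 = T_s - c E_s.

    The T_x span S because the braid relations make T_w independent of the
    reduced word of w (Matsumoto), which gives T_x T_s for all x and s.  They are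
    independent because the resulting formulas define an action of S on functions
    on pairs (permutation, torus element), in which T_s acts as P_s + c X_s:
    P_s exchanges two positions, and X_s is E_s at the permutations with a
    descent at s and 0 elsewhere.  The braid relation for these operators only
    involves three positions and reduces to identities between indicator
    functions of the six possible orders.

    The bar map is semilinear and satisfies bar (h T_s) = bar h T_s^-1, hence is
    an involution, unitriangular for the inversion number.  Since an element of
    Atilde with bar f = - f has the form g - bar g with g in v^-1 Z_b[v^-1], the
    same holds, degree by degree, for elements of S; applied to bar T_y - T_y,
    this gives C_y.  Uniqueness holds since no nonzero element with coefficients
    in v^-1 Z_b[v^-1] is bar invariant. *)

Require Import Defs.
From HB Require Import structures.
From mathcomp Require Import all_boot all_order all_algebra all_fingroup.
From mathcomp Require Import all_solvable generic_quotient boolp classical_sets.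
From mathcomp Require Import zify ring.

Set Implicit Arguments.
Unset Strict Implicit.
Unset Printing Implicit Defensive.

Import GRing.Theory Num.Theory.

(** * Inversions of permutations *)

Section Inversions.
Variable m : nat.
Implicit Types (t : 'S_m.+1) (i j : 'I_m).
Local Open Scope group_scope.

Definition lo i : 'I_m.+1 := widen_ord (leqnSn m) i.
Definition hi i : 'I_m.+1 := lift ord0 i.
Definition st i : 'S_m.+1 := tperm (lo i) (hi i).
(** The product [s * t] applies [s] first, so [st i * t] exchanges two adjacent entries in the
    one-line notation of [t]. Ascents and descents therefore refer to positions. *)
Definition asc t i : bool := t (lo i) < t (hi i).

Definition ninv t : nat :=
  #|[set p : 'I_m.+1 * 'I_m.+1 | (p.1 < p.2) && (t p.2 < t p.1)]|.

Lemma val_hi i : hi i = i.+1 :> nat. Proof. by []. Qed.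

Lemma lo_neq_hi i : lo i != hi i.
Proof. by rewrite -val_eqE /= /bump /= add1n neq_ltn ltnSn. Qed.

Lemma stK i : st i * st i = 1. Proof. exact: tperm2. Qed.
Lemma stV i : (st i)^-1 = st i. Proof. exact: tpermV. Qed.

Lemma desc_asc t i : ~~ asc t i = asc (st i * t) i.
Proof.
rewrite /asc !permM tpermL tpermR -leqNgt leq_eqVlt; case: eqP => //= /val_inj.
by move/perm_inj/eqP; rewrite eq_sym (negPf (lo_neq_hi i)).
Qed.

Lemma st_lt i (j k : 'I_m.+1) : (j < k)%N -> (j, k) != (lo i, hi i) ->
  (st i j < st i k)%N.
Proof.
rewrite xpair_eqE /st.
case: (tpermP _ _ j) => [->|->|/eqP + /eqP +];
  case: (tpermP _ _ k) => [->|->|/eqP + /eqP +];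
  rewrite -?val_eqE /= /bump /= ?add1n; lia.
Qed.

(** An adjacent transposition reverses the order of only one pair of positions. Hence [phi] carries
    the inversions of [t] onto those of [st i * t] other than [(lo i, hi i)]. *)
Lemma ninv_asc t i : asc t i -> ninv (st i * t) = (ninv t).+1.
Proof.
move=> t_i; pose phi (p : 'I_m.+1 * 'I_m.+1) := (st i p.1, st i p.2).
have sK : involutive (st i) by move=> j; rewrite -permM stK perm1.
have phiK : involutive phi by case=> j k; rewrite /phi /= !sK.
rewrite /ninv (cardsD1 (lo i, hi i)) inE /= /asc !permM tpermL tpermR.
rewrite -[bump 0 i]/(hi i : nat) val_hi ltnSn [_ < _]t_i /= add1n; congr _.+1.
rewrite -[RHS](card_imset _ (inv_inj phiK)); apply: eq_card => -[j k].
rewrite !inE; apply/and3P/imsetP => /= [[ne_jk lt_jk]|[[j' k']]].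
  rewrite !permM => lt_t; exists (phi (j, k)); rewrite ?phiK // inE /= lt_t.
  by rewrite st_lt.
rewrite inE => /andP[/= lt_jk lt_t] [-> ->]; rewrite !permM !sK; split=> //.
  apply: contraTneq lt_jk => -[/(canRL sK)-> /(canRL sK)->].
  by rewrite tpermL tpermR -leqNgt /= /bump /= add1n.
apply: st_lt => //; apply: contraTneq lt_t => -[-> ->].
by rewrite -leqNgt ltnW.
Qed.

Lemma ninv_desc t i : ~~ asc t i -> ninv t = (ninv (st i * t)).+1.
Proof. by rewrite desc_asc => /ninv_asc <-; rewrite mulgA stK mul1g. Qed.

Lemma ninv0P t : ninv t = 0%N <-> forall j k : 'I_m.+1, (j < k)%N ->
  (t j < t k)%N.
Proof.
split=> [inv0 j k lt_jk | t_homo].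
  rewrite ltnNge leq_eqVlt; apply/norP; split.
    apply: contraTneq lt_jk => /val_inj/perm_inj->.
    by rewrite ltnn.
  apply: contraT; rewrite negbK => lt_t; have /eqP := inv0; rewrite cards_eq0.
  by move/eqP/setP/(_ (j, k)); rewrite !inE lt_jk lt_t.
by apply: eq_card0 => p; rewrite !inE; case: ltnP => //= /t_homo /ltnW;
  rewrite leqNgt => /negPf.
Qed.

Lemma ninv_gt0_desc t : (0 < ninv t)%N -> exists i, ~~ asc t i.
Proof.
move=> ninv_gt0; apply/existsP; apply: contraLR ninv_gt0.
rewrite negb_exists -leqNgt leqn0 => /forallP t_asc; apply/eqP/ninv0P.
have t_next (j : 'I_m.+1) : (j.+1 < m.+1)%N -> (t j < t (inord j.+1))%N.
  move=> lt_jm; have := t_asc (Ordinal (lt_jm : (j < m)%N)); rewrite negbK /asc.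
  rewrite (_ : lo _ = j); last exact: val_inj.
  by rewrite (_ : hi _ = inord j.+1) //; apply: val_inj; rewrite /= inordK.
(* Without descents adjacent entries increase; this extends to all pairs by induction on the
   distance, which is [d.+1]. *)
have t_step d (j k : 'I_m.+1) : k = (j + d).+1 :> nat -> (t j < t k)%N.
  elim: d k => [|d IHd] k kE.
    rewrite addn0 in kE.
    rewrite (_ : k = inord j.+1); first by apply: t_next; rewrite -kE.
    by apply: val_inj; rewrite /= inordK -kE.
  have lt_m : ((j + d).+2 < m.+1)%N by rewrite -addnS -kE.
  have midE : (inord (j + d).+1 : 'I_m.+1) = (j + d).+1 :> nat.
    by rewrite inordK // ltnW.
  apply: ltn_trans (IHd _ midE) _; rewrite (_ : k =
    inord (inord (j + d).+1 : 'I_m.+1).+1).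
    by apply: t_next; rewrite midE.
  by apply: val_inj; rewrite /= midE kE addnS inordK.
by move=> j k lt_jk; apply: (t_step (k - j.+1)%N); rewrite -addSn subnKC.
Qed.

Lemma ninv1 : ninv 1 = 0%N.
Proof. by apply/ninv0P => j k; rewrite !perm1. Qed.

(** An increasing self-map of a finite initial segment never lies below the identity; this applies
    to both [t] and its inverse. *)
Lemma ninv0_eq1 t : ninv t = 0%N -> t = 1.
Proof.
have incr (u : 'S_m.+1) : (forall j k : 'I_m.+1, (j < k)%N -> (u j < u k)%N) ->
  forall j : 'I_m.+1, (j <= u j)%N.
  move=> u_homo [j lt_j]; elim: j lt_j => //= j IHj lt_j.
  by apply: leq_ltn_trans (IHj (ltnW lt_j)) _; apply: u_homo => /=.
move/ninv0P=> t_homo.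
have tV_homo (j k : 'I_m.+1) : (j < k)%N -> (t^-1 j < t^-1 k)%N.
  rewrite ltnNge -{1}[j](permKV t) -{1}[k](permKV t) => lt_jk.
  rewrite ltnNge leq_eqVlt; apply: contra lt_jk => /predU1P[/val_inj-> //|].
  by move/t_homo/ltnW.
apply/permP => j; rewrite perm1; apply/val_inj/eqP; rewrite eqn_leq.
by rewrite (incr t) // andbT -{2}[j](permK t) (incr t^-1).
Qed.
End Inversions.

Local Open Scope ring_scope.

(** * The monomial group *)

Section Words.
Variable m : nat.
Implicit Types (t : 'S_m.+1) (i j : 'I_m) (u : seq 'I_m).

(* The inverse of the permutation written by u, so that appending a letter
   acts on the left, that is on the positions, of the one-line notation. *)
Definition wperm u : 'S_m.+1 := foldl (fun t i => (st i * t)%g) 1%g u.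

Lemma wperm_rcons u i : wperm (rcons u i) = (st i * wperm u)%g.
Proof. exact: foldl_rcons. Qed.

Definition reduced u := ninv (wperm u) == size u.

Lemma ninv_wperm_rcons u i :
  (ninv (wperm (rcons u i)) <= (ninv (wperm u)).+1)%N.
Proof.
rewrite wperm_rcons.
have [/ninv_asc->//|/ninv_desc->] := boolP (asc (wperm u) i).
by rewrite ltnW.
Qed.

Lemma ninv_wperm u : (ninv (wperm u) <= size u)%N.
Proof.
elim/last_ind: u => [|u i IHu]; first by rewrite ninv1.
by rewrite size_rcons (leq_trans (ninv_wperm_rcons u i)).
Qed.

Lemma reduced_rcons u i : reduced (rcons u i) = reduced u && asc (wperm u) i.
Proof.
rewrite /reduced size_rcons wperm_rcons.
have [/ninv_asc->|/ninv_desc invE] := boolP (asc (wperm u) i);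
  first by rewrite eqSS andbT.
by rewrite andbF ltn_eqF // ltnS ltnW // -invE ninv_wperm.
Qed.

Lemma reduced_catl u v : reduced (u ++ v) -> reduced u.
Proof.
elim/last_ind: v => [|v i IHv]; first by rewrite cats0.
by rewrite -rcons_cat reduced_rcons => /andP[/IHv].
Qed.

(** Descents are stripped one at a time, by induction on the inversion number. *)
Lemma reduced_word t : exists2 u, wperm u = t & reduced u.
Proof.
move: {2}(ninv t) (erefl (ninv t)) => k; elim: k t => [|k IHk] t inv_t.
  by exists [::]; rewrite ?(ninv0_eq1 inv_t) // /reduced ninv1.
have [|i t_i] := @ninv_gt0_desc _ t; first by rewrite inv_t.
have := ninv_desc t_i; rewrite inv_t => -[/esym/IHk[u uE u_red]].
exists (rcons u i); first by rewrite wperm_rcons uE mulgA stK mul1g.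
by rewrite reduced_rcons u_red uE -desc_asc.
Qed.

Lemma wperm_cat u v : wperm (u ++ v) = (wperm v * wperm u)%g.
Proof.
elim/last_ind: v => [|v i IHv]; first by rewrite cats0 mul1g.
by rewrite -rcons_cat !wperm_rcons IHv mulgA.
Qed.

Lemma wperm_rev u : wperm (rev u) = (wperm u)^-1%g.
Proof.
elim: u => [|i u IHu]; first by rewrite invg1.
rewrite rev_cons wperm_rcons IHu -cat1s wperm_cat invMg; congr (_ * _)%g.
by rewrite /wperm /= mulg1 stV.
Qed.

Lemma reduced_rev u : reduced u -> reduced (rev u).
Proof.
(* The reverse of a reduced word of [t] is a word of [t^-1] with [ninv t] letters. Using the
   inequality for both [t] and [t^-1] gives equality. *)
have le_inv t : (ninv t^-1 <= ninv t)%N.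
  have [z <- /eqP->] := reduced_word t.
  by rewrite -wperm_rev -(size_rev z) ninv_wperm.
move=> /eqP u_red; rewrite /reduced size_rev -u_red wperm_rev eqn_leq le_inv.
by rewrite -{1}[wperm u]invgK le_inv.
Qed.

End Words.

(** * Pairs (permutation, torus element) as coordinates on the monomial group *)

Section Monomial.
Variables (F : finFieldType) (m b : nat) (Fb : {group {unit F}}).
Local Notation GL := {'GL_m.+1[F]}.
Local Notation tor := {ffun 'I_m.+1 -> {unit F}}.
Implicit Types (t : 'S_m.+1) (f d : tor) (u : seq 'I_m).

Definition permGL t : GL := FinRing.unit _ (unitmx_perm F t).

Lemma GLval_inj : injective (@GLval m.+1 F).
Proof. exact: val_inj. Qed.

Lemma permGLM : {morph permGL : s t / (s * t)%g}.
Proof. by move=> s t; apply: GLval_inj; rewrite /= perm_mxM. Qed.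

Lemma permGL1 : permGL 1 = 1%g.
Proof. by apply: GLval_inj; rewrite /= perm_mx1. Qed.

Lemma sgenE i : sgen F i = permGL (st i).
Proof. exact: GLval_inj. Qed.

Definition tmul f d : tor := [ffun j => (f j * d j)%g].
Definition tinv f : tor := [ffun j => (f j)^-1%g].
Definition tact t f : tor := [ffun j => f (t j)].

Lemma diagGLM f d : (diagGL f * diagGL d)%g = diagGL (tmul f d).
Proof.
apply: GLval_inj; rewrite /= -[LHS]/(_ *m _) mulmx_diag; congr diag_mx.
by apply/rowP => i; rewrite !mxE ffunE.
Qed.

Lemma diagGL1 : diagGL [ffun => 1%g] = 1%g :> GL.
Proof. by apply: GLval_inj; apply/matrixP => i j; rewrite !mxE ffunE. Qed.

Lemma diagGL_inj : injective (@diagGL F m).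
Proof.
move=> f d /(congr1 (@GLval _ _))/matrixP fd; apply/ffunP => i; apply: val_inj.
by have := fd i i; rewrite !mxE eqxx !mulr1n.
Qed.

Lemma diag_perm f t :
  (diagGL f * permGL t)%g = (permGL t * diagGL (tact t^-1 f))%g.
Proof.
apply: GLval_inj; rewrite /= -[LHS]/(_ *m _) -[RHS]/(_ *m _).
rewrite mul_diag_mx mul_mx_diag; apply/matrixP => i j; rewrite !mxE ffunE.
by case: eqP => [<-|_]; rewrite ?permK ?mulr1 ?mul1r ?mulr0 ?mul0r.
Qed.

Lemma diag_sgen f i :
  (diagGL f * sgen F i)%g = (sgen F i * diagGL (tact (st i) f))%g.
Proof. by rewrite sgenE diag_perm stV. Qed.

Lemma wordE u : word F u = permGL (wperm u)^-1.
Proof.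
rewrite /word; elim/last_ind: u => [|u i IHu].
  by rewrite big_nil invg1 permGL1.
by rewrite -cats1 big_cat big_seq1 /= IHu sgenE -permGLM cats1 wperm_rcons
  invMg stV.
Qed.

Lemma permGL_inj : injective permGL.
Proof.
move=> s t /(congr1 (@GLval _ _))/matrixP st; apply/permP => i.
have := st i (t i); rewrite !mxE eqxx; case: eqP => // _ /eqP.
by rewrite eq_sym oner_eq0.
Qed.

Lemma mem_Wperm x : x \in Wperm F m -> exists t, x = permGL t^-1.
Proof.
rewrite inE => /is_perm_mxP[s xs]; exists s^-1%g; rewrite invgK.
exact: GLval_inj.
Qed.

Lemma permGL_Wperm t : permGL t \in Wperm F m.
Proof. by rewrite inE; apply/is_perm_mxP; exists t. Qed.

Lemma mem_Hdiag f : (diagGL f \in Hdiag m Fb) = (f \in ffun_on (mem Fb)).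
Proof. by rewrite mem_imset //; apply: diagGL_inj. Qed.

Lemma permGL_Hdiag t : permGL t \in Hdiag m Fb -> t = 1%g.
Proof.
case/imsetP=> f _ /(congr1 (@GLval _ _))/matrixP tf; apply/permP => i.
rewrite perm1; have := tf i (t i); rewrite !mxE eqxx;
  case: (eqVneq i (t i)) => // _ /eqP.
by rewrite oner_eq0.
Qed.

(* The inverse matches the convention for wperm: right multiplication by s_i
   acts on the positions of k.1. *)
Definition gmon (k : 'S_m.+1 * tor) : GL := (permGL k.1^-1 * diagGL k.2)%g.

Definition Kmon : {set 'S_m.+1 * tor} := [set k | k.2 \in ffun_on (mem Fb)].

(** Any other permutation matrix that [pick] could return differs from this one by an element of
    both W and H_b, and these meet trivially. *)
Lemma wpart_gmon k : k \in Kmon -> wpart Fb (gmon k) = permGL k.1^-1.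
Proof.
rewrite inE => Fk; rewrite /wpart; case: pickP =>
  [w /andP[/mem_Wperm[t ->]]|/(_ (permGL k.1^-1))].
  rewrite /= /gmon mulgA => tk.
  have : permGL (t * k.1^-1) \in Hdiag_group m Fb.
    rewrite -[permGL _](mulgK (diagGL k.2)) groupM ?groupV ?mem_Hdiag //.
    suff -> : permGL (t * k.1^-1) = ((permGL t^-1)^-1 * permGL k.1^-1)%g by [].
    rewrite permGLM; congr (_ * _)%g; apply: (mulgI (permGL t^-1)).
    by rewrite mulgV -permGLM mulVg permGL1.
  by move/permGL_Hdiag/(canRL (mulgK _)); rewrite invgK mul1g => ->.
by rewrite permGL_Wperm mulKg mem_Hdiag Fk.
Qed.

Lemma dpart_gmon k : k \in Kmon -> dpart Fb (gmon k) = diagGL k.2.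
Proof. by move=> Kk; rewrite /dpart wpart_gmon // mulKg. Qed.

Lemma gmon_inj : {in Kmon &, injective gmon}.
Proof.
move=> [t f] [s d] Kt Ks eq_g; congr (_, _).
  apply/invg_inj/permGL_inj; rewrite -(wpart_gmon Kt) -(wpart_gmon Ks).
  by rewrite eq_g.
by apply: diagGL_inj; rewrite -(dpart_gmon Kt) -(dpart_gmon Ks) eq_g.
Qed.

Lemma WHbE : WHb m Fb = gmon @: Kmon.
Proof.
apply/setP => x; apply/mulsgP/imsetP =>
  [[w d /mem_Wperm[t ->] /imsetP[f Ff ->] ->]|[k]].
  by exists (t, f); rewrite // inE.
rewrite inE => Fk ->; exists (permGL k.1^-1) (diagGL k.2) => //;
  first exact: permGL_Wperm.
by rewrite mem_Hdiag.
Qed.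

(** The prefixes of a reduced word, the empty one included, represent pairwise distinct elements.
    This places [ninv t] inside the search range of [lenW]. *)
Lemma ninv_lt_GL t : (ninv t < #|{: GL}|)%N.
Proof.
have [u uE u_red] := reduced_word t.
pose pre (k : 'I_(size u).+1) := word F (take k u).
suff pre_inj : injective pre.
  by have := leq_card pre pre_inj; rewrite card_ord -(eqP u_red) uE.
move=> k l; rewrite /pre !wordE => /permGL_inj/invg_inj kl; apply: val_inj.
have take_red n : (n <= size u)%N -> ninv (wperm (take n u)) = n.
  move=> le_n; have := u_red; rewrite -{1}(cat_take_drop n u) =>
    /reduced_catl/eqP->.
  by rewrite size_takel.
have le_size (n : 'I_(size u).+1) : (n <= size u)%N by rewrite -ltnS.
by rewrite /= -(take_red k) ?le_size // kl take_red ?le_size.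
Qed.

Lemma lenW_perm t : lenW (permGL t^-1) = ninv t.
Proof.
rewrite /lenW; set N := #|_|; set P := (P in find P _).
have PE p : P p -> (ninv t <= p)%N.
  case/existsP=> u; rewrite wordE (inj_eq permGL_inj) (inj_eq invg_inj) =>
    /eqP <-.
  by rewrite -{2}(size_tuple u) ninv_wperm.
have Pt : P (ninv t).
  have [u uE /eqP u_red] := reduced_word t; rewrite -uE u_red.
  by apply/existsP; exists (in_tuple u); rewrite /= wordE uE.
have lt_tN := ninv_lt_GL t.
have hasP : has P (iota 0 N) by apply/hasP; exists (ninv t); rewrite ?mem_iota.
have lt_fN : (find P (iota 0 N) < N)%N by rewrite -{2}(size_iota 0 N) -has_find.
apply/eqP; rewrite eqn_leq PE ?andbT.
  rewrite leqNgt; apply/negP => /(before_find 0%N); rewrite nth_iota // add0n.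
  by rewrite Pt.
by have := nth_find 0%N hasP; rewrite nth_iota.
Qed.

Lemma redword_perm t :
  let u := redword (permGL t^-1) in wperm u = t /\ reduced u.
Proof.
rewrite /redword; case: pickP => [u|noP] /=.
  rewrite wordE (inj_eq permGL_inj) (inj_eq invg_inj) => /eqP uE; split=> //.
  by rewrite /reduced uE size_tuple lenW_perm.
(* The default value of [redword] is never taken: a reduced word has exactly the length over which
   [pick] ranges. *)
have [u uE /eqP u_red] := reduced_word t.
have sz_u : size u == lenW (permGL t^-1) by rewrite lenW_perm -u_red uE.
by have := noP (Tuple sz_u); rewrite /= wordE uE eqxx.
Qed.

Lemma len_gmon k : k \in Kmon -> len Fb (gmon k) = ninv k.1.
Proof. by move=> Kk; rewrite /len wpart_gmon ?lenW_perm. Qed.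

End Monomial.

(** * Algebras given by generators and relations *)

Section PalgInduction.
Variables (R : comNzRingType) (X : Type) (rels : term R X -> term R X -> Prop).
Implicit Types (x y : palg rels).

Lemma palg_rel t u : rels t u -> palg_pi rels t = palg_pi rels u.
Proof. by move=> tu; apply/palg_piE; apply: cong_rel. Qed.

Lemma palg_pi0 : palg_pi rels Zero = 0. Proof. by []. Qed.
Lemma palg_pi1 : palg_pi rels One = 1. Proof. by []. Qed.
Lemma palg_piDE t u :
  palg_pi rels (Add t u) = palg_pi rels t + palg_pi rels u.
Proof. by rewrite -palg_piD. Qed.
Lemma palg_piNE t : palg_pi rels (Opp t) = - palg_pi rels t.
Proof. by rewrite -palg_piN. Qed.
Lemma palg_piME t u :
  palg_pi rels (Mul t u) = palg_pi rels t * palg_pi rels u.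
Proof. by rewrite -palg_piM. Qed.
Lemma palg_piZE r t : palg_pi rels (Scale r t) = r *: palg_pi rels t.
Proof. by rewrite -palg_piZ. Qed.

Lemma palg_elim (P : palg rels -> Prop) :
    (forall g, P (palg_gen rels g)) -> P 0 -> P 1 ->
    (forall x, P x -> P (- x)) ->
    (forall x y, P x -> P y -> P (x + y)) ->
    (forall x y, P x -> P y -> P (x * y)) ->
    (forall r x, P x -> P (r *: x)) ->
  forall x, P x.
Proof.
move=> Pg P0 P1 PN PD PM PZ x; rewrite -(palg_reprK x).
elim: (palg_repr x) => {x} [g||| t IHt | t IHt u IHu | t IHt u IHu | r t IHt].
- exact: Pg.
- exact: P0.
- exact: P1.
- by rewrite palg_piNE; apply: PN.
- by rewrite palg_piDE; apply: PD.
- by rewrite palg_piME; apply: PM.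
- by rewrite palg_piZE; apply: PZ.
Qed.

End PalgInduction.

(** * Modules over presented algebras *)

Section PalgAction.
Variables (R S : comNzRingType) (phi : {rmorphism R -> S}) (M : lmodType S).
Variables (X : Type) (g : X -> M -> M).
Hypothesis g_linear : forall x, linear (g x).

(** Products act from the right: [Mul t u] applies [t] first. This makes a right regular
    representation available, with scalars acting through [phi]. *)
Fixpoint interp (t : term R X) (f : M) : M :=
  match t with
  | Gen x => g x f
  | Zero => 0
  | One => f
  | Opp t => - interp t f
  | Add t u => interp t f + interp u f
  | Mul t u => interp u (interp t f)
  | Scale r t => phi r *: interp t f
  end.

Lemma interp_linear t : linear (interp t).
Proof.
elim: t => [x||| t IHt | t IHt u IHu | t IHt u IHu | r t IHt] a f h //=.
- exact: g_linear.
- by rewrite scaler0 addr0.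
- by rewrite IHt opprD scalerN.
- by rewrite IHt IHu scalerDr addrACA.
- by rewrite IHt IHu.
- by rewrite IHt scalerDr !scalerA mulrC.
Qed.

Lemma interpD t f h : interp t (f + h) = interp t f + interp t h.
Proof. by have := interp_linear t 1 f h; rewrite !scale1r. Qed.

Lemma interp0 t : interp t 0 = 0.
Proof. by apply: (addIr (interp t 0)); rewrite -interpD !add0r. Qed.

Lemma interpZ t a f : interp t (a *: f) = a *: interp t f.
Proof. by have := interp_linear t a f 0; rewrite !addr0 interp0 addr0. Qed.

Variable rels : term R X -> term R X -> Prop.
Hypothesis interp_rels : forall t u, rels t u -> interp t =1 interp u.

(** Most algebra axioms hold pointwise; linearity of the operators is what gives left distributivity
    and the passage of scalars through a later factor. *)
Lemma interp_cong t u : cong rels t u -> interp t =1 interp u.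
Proof.
elim=> {t u} //=.
- by move=> t u _ IH f; rewrite IH.
- by move=> t u w _ IH1 _ IH2 f; rewrite IH1.
- by move=> t u _ IH f; rewrite IH.
- by move=> t t' u u' _ IH1 _ IH2 f; rewrite IH1 IH2.
- by move=> t t' u u' _ IH1 _ IH2 f; rewrite IH1 IH2.
- by move=> r t t' _ IH f; rewrite IH.
- by move=> t u w f; rewrite addrA.
- by move=> t u f; rewrite addrC.
- by move=> t f; rewrite add0r.
- by move=> t f; rewrite addNr.
- by move=> t u w f; rewrite interpD.
- by move=> r s t f; rewrite scalerA rmorphM.
- by move=> t f; rewrite rmorph1 scale1r.
- by move=> r t u f; rewrite scalerDr.
- by move=> r s t f; rewrite rmorphD scalerDl.
- by move=> r t u f; rewrite interpZ.
Qed.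

Definition palg_act (x : palg rels) (f : M) : M := interp (palg_repr x) f.

Lemma palg_act_pi t f : palg_act (palg_pi rels t) f = interp t f.
Proof. exact: (interp_cong (palg_piK rels t)). Qed.

Lemma palg_actDr x : {morph palg_act x : f h / f + h}.
Proof. exact: interpD. Qed.

Lemma palg_actZr x a f : palg_act x (a *: f) = a *: palg_act x f.
Proof. exact: interpZ. Qed.

Lemma palg_act1 f : palg_act 1 f = f.
Proof. exact: palg_act_pi. Qed.

Lemma palg_act_gen x f : palg_act (palg_gen rels x) f = g x f.
Proof. exact: palg_act_pi. Qed.

Lemma palg_actDl x y f : palg_act (x + y) f = palg_act x f + palg_act y f.
Proof. exact: palg_act_pi. Qed.

Lemma palg_actM x y f : palg_act (x * y) f = palg_act y (palg_act x f).
Proof. exact: palg_act_pi. Qed.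

Lemma palg_actZl r x f : palg_act (r *: x) f = phi r *: palg_act x f.
Proof. exact: palg_act_pi. Qed.

End PalgAction.

(** * Extension of scalars and extension of actions *)

Section Extension.
Variables (A B : comNzRingType) (phi : {rmorphism A -> B}).
Variables (X : Type) (rels : term A X -> term A X -> Prop).
Local Notation H := (palg rels).
Local Notation HB := (tensor_palg phi rels).

Definition ext (h : H) : HB := tensor phi 1 h.

Lemma tensorE c h : tensor phi c h = c *: ext h.
Proof.
rewrite /ext -[LHS]/(palg_pi _ (Gen (c, h))) -[c]mulr1.
by rewrite -(palg_rel (tensor_scale _ _ _ _)) palg_piZE mulr1.
Qed.

Lemma extD h h' : ext (h + h') = ext h + ext h'.
Proof.
rewrite -[LHS]/(palg_pi _ (Gen (1, h + h'))).
by rewrite (palg_rel (tensor_Dr _ _ _ _)) palg_piDE.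
Qed.

Lemma extZ r h : ext (r *: h) = phi r *: ext h.
Proof.
rewrite -tensorE -[LHS]/(palg_pi _ (Gen (1, r *: h))).
by rewrite -(palg_rel (tensor_balanced _ _ _ _)) mul1r.
Qed.

Lemma extM h h' : ext (h * h') = ext h * ext h'.
Proof.
rewrite -palg_piME -[X in Mul _ X]/(Gen (1, h')).
by rewrite (palg_rel (tensor_mul _ _ _ _ _)) mulr1.
Qed.

Lemma ext1 : ext 1 = 1.
Proof. by rewrite -[RHS]palg_pi1 (palg_rel (tensor_one _ _)). Qed.

Lemma ext0 : ext 0 = 0.
Proof. by apply: (addIr (ext 0)); rewrite -extD !add0r. Qed.

Lemma ext_sum I (r : seq I) (P : pred I) (f : I -> H) :
  ext (\sum_(i <- r | P i) f i) = \sum_(i <- r | P i) ext (f i).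
Proof. exact: (big_morph ext extD ext0). Qed.

Variables (M : lmodType B) (g : X -> M -> M).
Hypothesis g_linear : forall x, linear (g x).
Hypothesis g_rels : forall t u, rels t u -> interp phi g t =1 interp phi g u.

(** A pure tensor acts by its algebra factor followed by its scalar. The tensor relations then turn
    any action on a [B]-module into one of the extended algebra. *)
Let gT (ch : B * H) (f : M) : M := ch.1 *: palg_act phi g ch.2 f.

Let gT_linear ch : linear (gT ch).
Proof.
move=> a f h; rewrite /gT palg_actDr // palg_actZr // scalerDr !scalerA.
by rewrite mulrC.
Qed.

Let gT_rels t u : @tensor_rels A B phi X rels t u ->
  interp idfun gT t =1 interp idfun gT u.
Proof.
case=> {t u} /=.
- by move=> c c' h f; rewrite /gT scalerDl.
- by move=> c h h' f; rewrite /gT palg_actDl // scalerDr.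
- by move=> c r h f; rewrite /gT palg_actZl // scalerA.
- by move=> c c' h f; rewrite /gT scalerA.
- by move=> c c' h h' f; rewrite /gT palg_actM //= palg_actZr // scalerA mulrC.
- by move=> f; rewrite /gT palg_act1 // scale1r.
Qed.

Definition ext_act (h : HB) (f : M) : M :=
  palg_act (idfun : {rmorphism B -> B}) gT h f.

Lemma ext_act1 f : ext_act 1 f = f.
Proof. exact: palg_act1. Qed.
Lemma ext_actDl x y f : ext_act (x + y) f = ext_act x f + ext_act y f.
Proof. exact: palg_actDl. Qed.
Lemma ext_actM x y f : ext_act (x * y) f = ext_act y (ext_act x f).
Proof. exact: palg_actM. Qed.
Lemma ext_actZl r x f : ext_act (r *: x) f = r *: ext_act x f.
Proof. exact: palg_actZl. Qed.
Lemma ext_act_gen x f : ext_act (ext (palg_gen rels x)) f = g x f.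
Proof.
rewrite /ext_act /ext /tensor palg_act_gen // /gT /= palg_act_gen //.
exact: scale1r.
Qed.

End Extension.

(** * Laurent polynomials and the bar involution *)

Local Notation tofrac := (@FracField.tofrac {poly rat}).

Lemma evalVD p q : evalV (p + q) = evalV p + evalV q.
Proof. by rewrite /evalV rmorphD hornerD. Qed.

Lemma evalVN p : evalV (- p) = - evalV p.
Proof. by rewrite /evalV rmorphN hornerN. Qed.

Lemma evalVC c : evalV c%:P = cQ c.
Proof. by rewrite /evalV map_polyC hornerC. Qed.

Lemma tofrac_inj : injective tofrac.
Proof. by move=> p q /eqP; rewrite tofrac_eq => /eqP. Qed.

Lemma Qv_frac (f : Qv) : exists p q, q != 0 /\ f = tofrac p / tofrac q.
Proof.
exists \n_(repr f), \d_(repr f); split; first exact: denom_ratioP.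
by rewrite -tofrac_numden mulfK ?tofrac_eq0 ?denom_ratioP.
Qed.

Lemma barQ_tofrac p : barQ (tofrac p) = evalV p.
Proof.
by rewrite -[tofrac p]divr1 -tofrac1 barQE ?oner_neq0 // evalVC rmorph1 divr1.
Qed.

Lemma barQ1 : barQ 1 = 1.
Proof. by rewrite -tofrac1 barQ_tofrac evalVC rmorph1. Qed.

Lemma barQD f g : barQ (f + g) = barQ f + barQ g.
Proof.
have [p [q [q0 ->]]] := Qv_frac f; have [r [s [s0 ->]]] := Qv_frac g.
rewrite addf_div ?tofrac_eq0 // -!tofracM -tofracD !barQE ?mulf_neq0 //.
by rewrite evalVD !evalVM addf_div ?evalV_eq0.
Qed.

Lemma barQM f g : barQ (f * g) = barQ f * barQ g.
Proof.
have [p [q [q0 ->]]] := Qv_frac f; have [r [s [s0 ->]]] := Qv_frac g.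
rewrite mulf_div -!tofracM !barQE ?mulf_neq0 //.
by rewrite !evalVM mulf_div.
Qed.

Lemma barQN f : barQ (- f) = - barQ f.
Proof.
have [p [q [q0 ->]]] := Qv_frac f.
by rewrite -mulNr -tofracN !barQE // evalVN mulNr.
Qed.

Lemma barQv : barQ vQ = vQ^-1.
Proof. by rewrite barQ_tofrac (evalVXn 1). Qed.

Lemma barQvV : barQ vQ^-1 = vQ.
Proof.
by apply: (mulfI (invr_neq0 vQ_neq0));
  rewrite -{1}barQv -barQM divff ?vQ_neq0 // barQ1 mulVf ?vQ_neq0.
Qed.

Lemma barQX f k : barQ (f ^+ k) = barQ f ^+ k.
Proof. by elim: k => [|k IH]; rewrite ?barQ1 // !exprS barQM IH. Qed.

(** Writing p(1/v) as a reversed polynomial over a power of v, a second reversal gives p back. *)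
Lemma barQ_evalV p : barQ (evalV p) = tofrac p.
Proof.
rewrite (@evalV_revp (size p)) // -exprVn barQM barQX barQvV barQ_tofrac.
rewrite (@evalV_revp (size p)) ?size_poly // -mulrA mulVf ?expf_neq0 ?vQ_neq0
  //.
rewrite mulr1; congr tofrac; apply/polyP => i;
  rewrite !coef_poly !ltnS leq_subr.
by case: leqP => [/subKn->|/ltnW lt_pi] //; rewrite nth_default.
Qed.

Lemma barQK f : barQ (barQ f) = f.
Proof.
have [p [q [q0 ->]]] := Qv_frac f; rewrite barQE //.
apply: (mulIf (x := tofrac q)); rewrite ?tofrac_eq0 // divfK ?tofrac_eq0 //.
by rewrite -[X in _ * X]barQ_evalV -barQM divfK ?evalV_eq0 // barQ_evalV.
Qed.

Lemma tofracXM_evalV (N : nat) (p : {poly rat}) : (size p <= N.+1)%N ->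
  tofrac (revp N p) = tofrac 'X^N * evalV p.
Proof.
by move=> sp; rewrite (evalV_revp sp) tofracXn mulrCA mulfV ?mulr1 ?expf_neq0
  ?vQ_neq0.
Qed.

(** Invariance equates v p(v), with only positive powers of v, to an element with only negative
    ones. After clearing denominators the sizes of the two sides disagree unless p = 0. *)
Lemma vevalV_fixed p : barQ (vQ^-1 * evalV p) = vQ^-1 * evalV p -> p = 0.
Proof.
rewrite barQM barQvV barQ_evalV => fix_p.
have sp : (size p <= (size p).+1)%N by [].
have /tofrac_inj Xp : tofrac ('X^((size p).+2) * p) = tofrac (revp (size p) p).
  rewrite (tofracXM_evalV sp) tofracM !tofracXn -/vQ exprSr -mulrA fix_p.
  by rewrite exprSr -mulrA mulVKf ?vQ_neq0.
apply/eqP; apply: contraT => p0; have := congr1 (size \o val) Xp => /=.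
rewrite mulrC size_mulXn // => sz.
have := size_poly (size p).+1 (fun i => p`_(size p - i)).
by rewrite -/(revp _ _) -sz => /(leq_trans (leq_addr _ _)); rewrite ltnn.
Qed.

(** Comparing coefficients of p(v) and - p(1/v) kills every positive degree; the constant term
    equals its own negative, hence vanishes in characteristic 0. *)
Lemma evalV_antifixed p : tofrac p = - evalV p -> p = 0.
Proof.
move=> anti_p; have sp : (size p <= (size p).+1)%N by [].
have /tofrac_inj Xp : tofrac ('X^(size p) * p) = tofrac (- revp (size p) p).
  by rewrite tofracN (tofracXM_evalV sp) tofracM anti_p mulrN.
apply/polyP => j; have := congr1 (fun r : {poly rat} => r`_(size p + j)) Xp.
rewrite coefXnM coefN coef_poly ltnNge leq_addr /= addKn ltnS -{2}[size p]addn0.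
rewrite leq_add2l coef0; case: j => [|j] /=; last by rewrite oppr0.
rewrite addn0 subnn => /eqP; rewrite -subr_eq0 opprK -mulr2n mulrn_eq0 /=.
by move/eqP.
Qed.

Section Atilde.
Variable b : nat.
Implicit Types f g : Atilde b.

Fact Abar_is_additive : zmod_morphism (@Abar b).
Proof. by move=> f g; apply: val_inj; rewrite /= barQD barQN. Qed.
HB.instance Definition _ := GRing.isZmodMorphism.Build (Atilde b) (Atilde b)
  (@Abar b) Abar_is_additive.

Fact Abar_is_multiplicative : monoid_morphism (@Abar b).
Proof. by split=> [|f g]; apply: val_inj; rewrite /= ?barQ1 ?barQM. Qed.
HB.instance Definition _ := GRing.isMonoidMorphism.Build (Atilde b) (Atilde b)
  (@Abar b) Abar_is_multiplicative.

Lemma AbarK : involutive (@Abar b).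
Proof. by move=> f; apply: val_inj; rewrite /= barQK. Qed.

Lemma Avinv_mulr : Avinv b * Av b = 1.
Proof. by apply: val_inj; rewrite /= mulVf ?vQ_neq0. Qed.

Lemma Abar_v : Abar (Av b) = Avinv b.
Proof. by apply: val_inj; rewrite /= barQv. Qed.

Lemma Abar_vinv : Abar (Avinv b) = Av b.
Proof. by apply: val_inj; rewrite /= barQvV. Qed.

Lemma Abar_invb : Abar (Ainvb b) = Ainvb b.
Proof. by apply: val_inj; rewrite /= barQ_tofrac evalVC. Qed.

(* Chosen so that T_s ^ 2 = 1 + KLc E_s T_s, where E_s sums T_d over X_s. *)
Definition KLc : Atilde b := Ainvb b * (Av b - Avinv b).

Lemma Abar_KLc : Abar KLc = - KLc.
Proof.
by rewrite rmorphM rmorphB /= Abar_v Abar_vinv Abar_invb -mulrN opprB.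
Qed.

Lemma Aneg0 : Aneg (0 : Atilde b).
Proof. by exists 0; rewrite rpred0 /evalV map_poly0 horner0 mulr0. Qed.

Lemma AnegD f g : Aneg f -> Aneg g -> Aneg (f + g).
Proof.
move=> [p [pZ fp]] [r [rZ gr]]; exists (p + r); split; first exact: rpredD.
by rewrite evalVD mulrDr -fp -gr.
Qed.

Lemma AnegN f : Aneg f -> Aneg (- f).
Proof.
move=> [p [pZ fp]]; exists (- p); split; first by rewrite rpredN.
by rewrite evalVN mulrN -fp.
Qed.

Lemma Aneg_fixed f : Aneg f -> Abar f = f -> f = 0.
Proof.
move=> [p [pZ fp]] /(congr1 val); rewrite /= fp => /vevalV_fixed p0.
by apply: val_inj; rewrite fp p0 /evalV map_poly0 horner0 mulr0.
Qed.

(* Split off the part of f of negative degree in v; what remains after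
   subtracting it antisymmetrically is a polynomial in v. *)
Lemma Abar_antifixed f : Abar f = - f -> exists2 g, Aneg g & f = g - Abar g.
Proof.
case: f => f0 fL anti_f; have /asboolP[p [k [pZ f0E]]] := fL.
pose r := \poly_(j < k) p`_(k.-1 - j).
pose s := drop_poly k p.
have rZ : r \is a polyOver (Zb b).
  apply/polyOverP => j; rewrite coef_poly.
  by case: ifP => _; [apply: (polyOverP pZ) | rewrite rpred0].
have gL : vQ^-1 * evalV r \in laurent b.
  rewrite rpredM ?laurent_vinv // -barQ_tofrac barQ_laurent //.
  exact: laurent_poly.
have f0D : f0 = tofrac s + vQ^-1 * evalV r.
  rewrite f0E -{1}(poly_take_drop k p) tofracD tofracM tofracXn -/vQ mulrDl.
  rewrite mulfK ?expf_neq0 ?vQ_neq0 // addrC; congr (_ + _).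
  case: k @r rZ gL {s} f0E => [|k] r rZ gL f0E.
    rewrite take_poly0l tofrac0 mul0r /evalV.
    by rewrite (_ : r = 0) ?map_poly0 ?horner0 ?mulr0 // /r poly_def big_ord0.
  have sr : (size r <= k.+1)%N by apply: size_poly.
  rewrite (evalV_revp sr) mulrCA -invfM -exprS; congr (tofrac _ / _).
  apply/polyP => i; rewrite coef_take_poly coef_poly; case: ifP => // ik.
  by rewrite coef_poly ltnS leq_subr /= subKn.
exists (MkAtilde gL); first by exists r.
apply: val_inj => /=; move/(congr1 val): anti_f => /=.
rewrite f0D barQD barQM barQvV barQ_evalV barQ_tofrac opprD => anti.
have /evalV_antifixed s0 : tofrac (s + 'X * r) = - evalV (s + 'X * r).
  rewrite tofracD tofracM evalVD evalVM (evalVXn 1) expr1 opprD.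
  apply/eqP; rewrite -subr_eq0 opprD !opprK; move/eqP: anti.
  by rewrite -subr_eq0 opprD !opprK addrACA [_ + tofrac s]addrC addrACA.
move/eqP: s0; rewrite addrC addr_eq0 => /eqP s0.
by rewrite -[vQ]/(tofrac 'X) -tofracM s0 tofracN opprK addrC.
Qed.

Definition specialize_coef : {rmorphism {poly int} -> Atilde b} :=
  horner_eval (Ainvb b * (Av b ^+ 2 - 1)) \o map_poly intr.

HB.instance Definition _ := GRing.RMorphism.copy (@specialize b)
  (horner_eval (Av b) \o map_poly specialize_coef).

Lemma specializeE (p : {poly {poly int}}) :
  specialize b p = (map_poly specialize_coef p).[Av b].
Proof. by []. Qed.

Lemma specialize_a : specialize b ('X : {poly int})%:P =
  Ainvb b * (Av b ^+ 2 - 1).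
Proof. by rewrite specializeE map_polyC hornerC /= map_polyX /horner_eval
  hornerX. Qed.

Lemma specialize_v : specialize b 'X = Av b.
Proof. by rewrite specializeE map_polyX hornerX. Qed.

End Atilde.

(** * Bar-invariant elements of a module with a unitriangular involution *)

Section KLBasis.
Variables (b : nat) (V : lmodType (Atilde b)) (I : finType) (P : {set I}).
Variables (T : I -> V) (cf : V -> I -> Atilde b) (len : I -> nat).
Variable bar : V -> V.
Hypothesis cfD : forall g h x, cf (g + h) x = cf g x + cf h x.
Hypothesis cfZ : forall r h x, cf (r *: h) x = r * cf h x.
Hypothesis cfT : {in P &, forall x y, cf (T x) y = (y == x)%:R}.
Hypothesis cf_sum : forall h, h = \sum_(x in P) cf h x *: T x.
Hypothesis barD : {morph bar : g h / g + h}.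
Hypothesis barZ : forall r h, bar (r *: h) = Abar r *: bar h.
Hypothesis barK : involutive bar.
Hypothesis bar_unitriangular :
  {in P &, forall x y, (len x <= len y)%N -> cf (bar (T x)) y = (y == x)%:R}.
Implicit Types (g h u : V) (x y : I) (N : nat).

Definition below N h := {in P, forall x, (N <= len x)%N -> cf h x = 0}.

Lemma cfN h x : cf (- h) x = - cf h x.
Proof. by rewrite -scaleN1r cfZ mulN1r. Qed.

Lemma cf0 x : cf 0 x = 0.
Proof. by rewrite -(scale0r 0) cfZ mul0r. Qed.

Lemma barN h : bar (- h) = - bar h.
Proof. by rewrite -scaleN1r barZ rmorphN1 scaleN1r. Qed.

Lemma bar0 : bar 0 = 0.
Proof. by rewrite -(scale0r 0) barZ rmorph0 !scale0r. Qed.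

Lemma cf_bigsum (Q : pred I) (h : I -> V) y :
  cf (\sum_(x | Q x) h x) y = \sum_(x | Q x) cf (h x) y.
Proof. by apply: (big_morph (cf^~ y)) => [g' h'|]; rewrite ?cfD ?cf0. Qed.

Lemma cf_eq0 h : {in P, forall x, cf h x = 0} -> h = 0.
Proof.
by move=> h0; rewrite [h]cf_sum big1 // => x Px; rewrite h0 ?scale0r.
Qed.

(** Every [x] in the support of [h] has length at most [len y], so by unitriangularity only [x = y]
    contributes to this coordinate. *)
Lemma cf_bar_top N h y : below N h -> y \in P -> (N <= (len y).+1)%N ->
  cf (bar h) y = Abar (cf h y).
Proof.
move=> hN Py le_Ny; rewrite {1}[h]cf_sum (big_morph bar barD bar0) cf_bigsum.
transitivity (\sum_(x in P) Abar (cf h x) * (y == x)%:R).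
  apply: eq_bigr => x Px; rewrite barZ cfZ.
  have [le_Nx|lt_xN] := leqP N (len x); first by rewrite hN // rmorph0 !mul0r.
  by rewrite bar_unitriangular // -ltnS (leq_trans lt_xN).
rewrite (bigD1 y) //= eqxx mulr1 big1 ?addr0 // => x /andP[_].
by rewrite eq_sym => /negPf->; rewrite mulr0.
Qed.

(** In top degree the coordinates are themselves bar invariant and in [Aneg], hence zero; the bound
    on the degree thus descends to 0. *)
Lemma Aneg_bar_fixed h : {in P, forall x, Aneg (cf h x)} -> bar h = h -> h = 0.
Proof.
move=> hneg hbar; suff below0 N : below N h -> h = 0.
  apply: (below0 (\max_x len x).+1) => x _; rewrite ltnNge.
  by rewrite (leq_bigmax x).
elim: N => [h0|N IHN hN]; first by apply: cf_eq0 => x Px; apply: h0.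
apply: IHN => x Px; rewrite leq_eqVlt => /predU1P[len_x|]; last exact: hN.
by apply: (Aneg_fixed (hneg x Px)); rewrite -(cf_bar_top hN) ?hbar ?len_x.
Qed.

(** The top coordinates of [h] are antifixed, so they have the form a - bar a. Collecting the [a x]
    in [u0] and subtracting [u0 - bar u0], which is antifixed because [bar] is an involution, lowers
    the degree. *)
Lemma bar_antifixed N h : below N h -> bar h = - h ->
  exists u, [/\ below N u, {in P, forall x, Aneg (cf u x)} & h = u - bar u].
Proof.
elim: N h => [h h0 _|N IHN h hN anti_h].
  exists 0; rewrite bar0 subr0 (cf_eq0 (fun x Px => h0 x Px isT));
    split=> // x _; rewrite cf0 //.
  exact: Aneg0.
have /choice[a aP] x : exists a : Atilde b,
    Aneg a /\ (x \in P -> len x = N -> cf h x = a - Abar a).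
  have [/andP[Px /eqP len_x]|not_top] := boolP ((x \in P) && (len x == N)).
    have [|a aneg ha] := @Abar_antifixed b (cf h x); last by exists a.
    by rewrite -(cf_bar_top hN) ?len_x // anti_h cfN.
  by exists 0; split=> [|Px len_x]; [apply: Aneg0 | rewrite Px len_x eqxx in
    not_top].
pose u0 := \sum_(x in P | len x == N) a x *: T x.
have cf_u0 y : y \in P -> cf u0 y = if len y == N then a y else 0.
  move=> Py; rewrite cf_bigsum.
  transitivity (\sum_(x in P | len x == N) a x * (y == x)%:R).
    by apply: eq_bigr => x /andP[Px _]; rewrite cfZ cfT.
  case: ifPn => [len_y|len_y].
    rewrite (bigD1 y) ?Py //= eqxx mulr1 big1 ?addr0 // => x /andP[_].
    by rewrite eq_sym => /negPf->; rewrite mulr0.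
  rewrite big1 // => x /andP[_ len_x]; case: eqP => [yx|];
    last by rewrite mulr0.
  by rewrite yx len_x in len_y.
have u0N : below N.+1 u0 by move=> x Px lt_Nx; rewrite cf_u0 // gtn_eqF.
have [||u1 [u1N u1neg u1E]] := IHN (h - (u0 - bar u0)).
- move=> x Px le_Nx; rewrite !(cfD, cfN) (cf_bar_top u0N) // cf_u0 //.
  move: le_Nx; rewrite leq_eqVlt => /predU1P[len_x|lt_Nx].
    by rewrite -len_x eqxx (proj2 (aP x)) // subrr.
  by rewrite hN // gtn_eqF // rmorph0 !subr0.
- by rewrite !(barD, barN) barK anti_h !opprD !opprK [- bar u0 + _]addrC.
exists (u0 + u1); split.
- by move=> x Px lt_Nx; rewrite cfD u0N // u1N ?addr0 // ltnW.
- move=> x Px; rewrite cfD cf_u0 //; apply: AnegD; last exact: u1neg.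
  by case: ifP => _; [apply: (proj1 (aP x)) | apply: Aneg0].
- by rewrite barD opprD addrACA -u1E addrC subrK.
Qed.

Lemma KL_exists_unique y : y \in P ->
  exists! C : V, bar C = C /\ {in P, forall x, Aneg (cf (C - T y) x)}.
Proof.
(* The top terms of [bar (T y)] and [T y] cancel, which gives the bound [len y]. From bar T_y - T_y
   = u - bar u it follows that T_y + u is bar invariant. *)
move=> Py; have [||u [_ uneg uE]] := @bar_antifixed (len y) (bar (T y) - T y).
- by move=> x Px le_yx; rewrite cfD cfN bar_unitriangular // cfT // subrr.
- by rewrite barD barN barK opprB.
exists (T y + u); have barC0 : bar (T y + u) = T y + u.
  rewrite barD; move/eqP: uE; rewrite subr_eq => /eqP->.
  by rewrite addrAC subrK addrC.
split=> [|C [barC Cneg]]; first by split; rewrite // addrC addKr.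
apply/esym/subr0_eq; apply: Aneg_bar_fixed;
  last by rewrite barD barN barC barC0.
move=> x Px; rewrite opprD addrA cfD cfN.
by apply: AnegD; [apply: Cneg | apply/AnegN/uneg].
Qed.

End KLBasis.

(** * Relations in the Hecke algebra *)

Section TorusElements.
Variables (F : finFieldType) (m b : nat) (Fb : {group {unit F}}).
Hypothesis hFb : #|Fb| = b.
Local Notation tor := {ffun 'I_m.+1 -> {unit F}}.
Local Notation n := m.+1.

(* The sign (-1)^(b-1) in the definition of h_{i,j}. *)
Definition eps : {unit F} := (m1F F ^+ b.-1)%g.

Lemma unitC (x y : {unit F}) : (x * y = y * x)%g.
Proof. by apply: val_inj; rewrite /= mulrC. Qed.

Lemma m1F2 : (m1F F * m1F F = 1)%g.
Proof. by apply: val_inj; rewrite /= mulrNN mulr1. Qed.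

Lemma eps2 : (eps * eps = 1)%g.
Proof. by rewrite /eps -expgMn ?m1F2 ?expg1n //; apply: unitC. Qed.

(* For b even, F_b has an element of order 2, which can only be -1. *)
Lemma eps_Fb : eps \in Fb.
Proof.
rewrite /eps; have b_gt0 : (0 < b)%N by rewrite -hFb cardG_gt0.
have [b_odd|b_even] := boolP (odd b).
  rewrite -(odd_double_half b.-1) -subn1 oddB // b_odd /= -mul2n expgM.
  by rewrite expgS expg1 m1F2 expg1n group1.
rewrite groupX //; have [|x Fx ox] := @Cauchy _ 2 Fb isT;
  first by rewrite hFb dvdn2.
suff -> : m1F F = x by [].
have x2 : (x * x = 1)%g by rewrite -[(x * x)%g]/(x ^+ 2)%g -ox expg_order.
apply: val_inj => /=; have /eqP := congr1 val x2; rewrite /= -expr2 sqrf_eq1.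
case/orP=> /eqP // x1; have : x = 1%g by apply: val_inj.
by move=> x_eq1; rewrite x_eq1 order1 in ox.
Qed.

Lemma epsM_Fb x : ((eps * x)%g \in Fb) = (x \in Fb).
Proof. by rewrite groupMl ?eps_Fb. Qed.

Definition hx (j k : 'I_n) (x : {unit F}) : tor :=
  [ffun l => if l == j then x else if l == k then (eps * x^-1)%g else 1%g].

Lemma htwoE j k x : j != k -> htwo b j k x = diagGL (hx j k x).
Proof.
move=> jk; rewrite /htwo /hone diagGLM; congr diagGL; apply/ffunP => l.
rewrite !ffunE; case: (eqVneq l j) => [->|_]; first by rewrite (negPf jk) mulg1.
by rewrite mul1g.
Qed.

Lemma hx_Fb j k x : x \in Fb -> hx j k x \in ffun_on (mem Fb).
Proof.
move=> Fx; apply/ffun_onP => l; rewrite ffunE.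
by case: ifP => // _; case: ifP; rewrite ?group1 ?groupM ?groupV ?eps_Fb.
Qed.

Lemma sum_Xs (V : nmodType) (i : 'I_m) (phi : {'GL_n[F]} -> V) :
  \sum_(d in Xs b Fb i) phi d =
  \sum_(x in Fb) phi (diagGL (hx (lo i) (hi i) x)).
Proof.
rewrite /Xs -/(lo i) -/(hi i) big_imset /=.
  by apply: eq_bigr => x _; rewrite htwoE ?lo_neq_hi.
move=> x y _ _; rewrite !htwoE ?lo_neq_hi // => /diagGL_inj/ffunP/(_ (lo i)).
by rewrite !ffunE eqxx.
Qed.

(** Since [eps] lies in F_b, this substitution permutes F_b; on [hx] it exchanges the two
    coordinates, so E_s is symmetric in them. *)
Lemma sum_epsV (V : nmodType) (phi : {unit F} -> V) :
  \sum_(x in Fb) phi (eps * x^-1)%g = \sum_(x in Fb) phi x.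
Proof.
rewrite [RHS](reindex_inj (h := fun x => (eps * x^-1)%g)) /=.
  by apply: eq_bigl => x; rewrite epsM_Fb groupV.
by move=> x y /mulgI/invg_inj.
Qed.

Lemma hxC j k x : j != k -> hx j k (eps * x^-1)%g = hx k j x.
Proof.
move=> jk; apply/ffunP => l; rewrite !ffunE invMg invgK.
case: (eqVneq l j) => [->|_]; first by rewrite (negPf jk).
by case: ifP => // _; rewrite [(x * _)%g]unitC mulKVg.
Qed.

Lemma tact_hx (t : 'S_n) j k x : tact t (hx j k x) = hx (t^-1%g j) (t^-1%g k) x.
Proof.
by apply/ffunP => l; rewrite !ffunE !(canF_eq (permK t)).
Qed.

Lemma sum_tact_hx (V : nmodType) (i : 'I_m) (phi : tor -> V) :
  \sum_(x in Fb) phi (tact (st i) (hx (lo i) (hi i) x)) =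
  \sum_(x in Fb) phi (hx (lo i) (hi i) x).
Proof.
rewrite -[LHS]sum_epsV; apply: eq_bigr => x _.
by rewrite hxC ?lo_neq_hi // tact_hx stV tpermR tpermL.
Qed.

(** Multiplying the summation variable by [r] turns h(x) f into h(x) times the transform of f by
    s_i. This is why E_s absorbs the twist of a torus element by s. *)
Lemma sum_hx_tact (V : nmodType) (i : 'I_m) (f : tor) (phi : tor -> V) :
    f \in ffun_on (mem Fb) ->
  \sum_(x in Fb) phi (tmul (hx (lo i) (hi i) x) (tact (st i) f)) =
  \sum_(x in Fb) phi (tmul (hx (lo i) (hi i) x) f).
Proof.
move=> Ff; have Ff' := ffun_onP Ff; pose r := (f (hi i) * (f (lo i))^-1)%g.
have Fr : r \in Fb by rewrite groupM ?groupV ?Ff'.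
rewrite [RHS](reindex_inj (mulIg r)) /=.
apply: eq_big => [x|x Fx]; first by rewrite groupMr.
congr phi; apply/ffunP => l; rewrite !ffunE.
have [->|l_lo] := eqVneq l (lo i); first by rewrite tpermL -mulgA mulgKV.
have [->|l_hi] := eqVneq l (hi i); last by rewrite tpermD // eq_sym.
rewrite tpermR (_ : f (lo i) = r^-1 * f (hi i))%g;
  last by rewrite invMg invgK mulgKV.
by rewrite (invMg x r) [(r^-1 * x^-1)%g]unitC !mulgA.
Qed.

End TorusElements.

Section Relations.
Variables (F : finFieldType) (m b : nat) (Fb : {group {unit F}}).
Hypothesis hFb : #|Fb| = b.
Local Notation tor := {ffun 'I_m.+1 -> {unit F}}.
Local Notation onFb := (ffun_on (mem Fb)).
Local Notation H := (heckeT m b Fb).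
Local Notation c := (KLc b).
Local Notation phi := (@specialize b : {rmorphism _ -> _}).
Local Notation ex := (@ext _ _ phi _ (@hecke_rels F m b Fb)).
Implicit Types (f d : tor) (i j : 'I_m).

Lemma hecke_scaleAl (r : Atilde b) (x y : H) : r *: (x * y) = (r *: x) * y.
Proof. exact: palg_scalerAl. Qed.
Lemma hecke_scaleAr (r : Atilde b) (x y : H) : r *: (x * y) = x * (r *: y).
Proof. exact: palg_scalerAr. Qed.

Definition Ts i : H := Avinv b *: ex (ts b Fb i).
Definition Dt f : H := ex (td b Fb (diagGL f)).
Definition Es i : H := \sum_(x in Fb) Dt (hx b (lo i) (hi i) x).

Local Notation Hk := (palg (@hecke_rels F m b Fb)).
Local Notation hs i := (ts b Fb i : Hk).
Local Notation hd d := (td b Fb d : Hk).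

Lemma td1 : hd 1%g = 1.
Proof. exact: (palg_rel (hecke_1 m b Fb)). Qed.

Lemma tdM (d d' : {'GL_m.+1[F]}) : d \in Hdiag m Fb -> d' \in Hdiag m Fb ->
  hd d * hd d' = hd (d * d')%g.
Proof.
by move=> Hd Hd'; rewrite -palg_piME; exact: (palg_rel (hecke_dd b Hd Hd')).
Qed.

Lemma td_ts (d : {'GL_m.+1[F]}) i : d \in Hdiag m Fb ->
  hd d * hs i = hs i * hd (sgen F i * d * sgen F i)%g.
Proof.
by move=> Hd; rewrite -!palg_piME; exact: (palg_rel (hecke_ds b i Hd)).
Qed.

Lemma ts_comm i j : (i.+1 < j)%N || (j.+1 < i)%N -> hs i * hs j = hs j * hs i.
Proof.
by move=> ij; rewrite -!palg_piME; exact: (palg_rel (hecke_comm b Fb ij)).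
Qed.

Lemma ts_braid i j : j = i.+1 :> nat -> hs i * hs j * hs i = hs j * hs i * hs j.
Proof.
by move=> ij; rewrite /ts /palg_gen -!palg_piME;
  exact: (palg_rel (hecke_braid b Fb ij)).
Qed.

Lemma ts_quad i :
  hs i * hs i = ('X ^+ 2 : {poly {poly int}}) *: (1 : Hk) +
  (('X : {poly int})%:P : {poly {poly int}}) *:
    (\sum_(d in Xs b Fb i) hd d * hs i).
Proof.
rewrite -[LHS]palg_piME (palg_rel (hecke_quad b Fb i)) palg_piDE !palg_piZE.
congr (_ + _ *: _).
by rewrite (big_morph (palg_pi _) (@palg_piDE _ _ _) (@palg_pi0 _ _ _));
  apply: eq_bigr => d _; rewrite palg_piME.
Qed.

Lemma Dt1 : Dt [ffun=> 1%g] = 1.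
Proof. by rewrite /Dt diagGL1 td1 ext1. Qed.

Lemma DtM f d : f \in onFb -> d \in onFb -> Dt f * Dt d = Dt (tmul f d).
Proof. by move=> Ff Fd; rewrite /Dt -extM -diagGLM tdM ?mem_Hdiag. Qed.

Lemma DtTs f i : f \in onFb -> Dt f * Ts i = Ts i * Dt (tact (st i) f).
Proof.
move=> Ff; rewrite /Ts -hecke_scaleAl -hecke_scaleAr; congr (_ *: _).
rewrite /Dt -!extM td_ts ?mem_Hdiag // -mulgA diag_sgen mulgA.
by rewrite sgenE -permGLM stK permGL1 mul1g.
Qed.

Lemma Ts_comm i j : (i.+1 < j)%N || (j.+1 < i)%N -> Ts i * Ts j = Ts j * Ts i.
Proof.
by move=> ij; rewrite /Ts -!hecke_scaleAl -!hecke_scaleAr -!extM ts_comm.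
Qed.

Lemma Ts_braid i j : j = i.+1 :> nat -> Ts i * Ts j * Ts i = Ts j * Ts i * Ts j.
Proof.
by move=> ij; rewrite /Ts -!(hecke_scaleAl, hecke_scaleAr) -!extM ts_braid.
Qed.

Lemma ts_Ts i : ex (hs i) = Av b *: Ts i.
Proof. by rewrite /Ts scalerA mulrC Avinv_mulr scale1r. Qed.

Lemma EsE i : Es i * Ts i = Avinv b *: ex (\sum_(d in Xs b Fb i) hd d * hs i).
Proof.
rewrite /Ts -hecke_scaleAr sum_Xs ext_sum mulr_suml; congr (_ *: _).
by apply: eq_bigr => x _; rewrite -extM.
Qed.

Lemma Ts_quad i : Ts i * Ts i = 1 + c *: (Es i * Ts i).
Proof.
rewrite EsE /Ts -!(hecke_scaleAl, hecke_scaleAr) -!extM ts_quad.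
rewrite extD !extZ ext1 !scalerDr !scalerA rmorphXn /= specialize_v
  specialize_a.
have v2 : Avinv b * Avinv b * Av b ^+ 2 = 1.
  by rewrite expr2 mulrACA Avinv_mulr mulr1.
rewrite v2 scale1r; congr (_ + _ *: _).
by rewrite mulrCA mulrBr v2 mulr1 /KLc -mulrA mulrBl [Av b * _]mulrC Avinv_mulr.
Qed.

Lemma EsDt i f : f \in onFb -> Es i * Dt f = Dt f * Es i.
Proof.
move=> Ff; rewrite mulr_suml mulr_sumr; apply: eq_bigr => x Fx.
rewrite !DtM ?hx_Fb //; congr Dt; apply/ffunP => l; rewrite !ffunE;
  exact: unitC.
Qed.

Lemma TsEs i : Ts i * Es i = Es i * Ts i.
Proof.
rewrite /Es -[in LHS](sum_tact_hx hFb i Dt).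
rewrite mulr_suml mulr_sumr; apply: eq_bigr => x Fx.
by rewrite DtTs ?hx_Fb.
Qed.

Lemma Es_tact i f : f \in onFb -> Es i * Dt (tact (st i) f) = Es i * Dt f.
Proof.
move=> Ff; have Fsf : tact (st i) f \in onFb.
  by apply/ffun_onP => l; rewrite ffunE (ffun_onP Ff).
rewrite !mulr_suml -[RHS](eq_bigr _ (fun x Fx =>
  esym (DtM (hx_Fb hFb _ _ Fx) Ff))).
rewrite -(sum_hx_tact b i Dt Ff).
by apply: eq_bigr => x Fx; rewrite DtM ?hx_Fb.
Qed.

End Relations.

(** * Independence of the reduced word *)

Section Matsumoto.
Variables (m : nat) (R : pzRingType) (T : 'I_m -> R).
Hypothesis T_comm : forall i j : 'I_m, (i.+1 < j)%N || (j.+1 < i)%N ->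
  T i * T j = T j * T i.
Hypothesis T_braid : forall i j : 'I_m, j = i.+1 :> nat ->
  T i * T j * T i = T j * T i * T j.
Implicit Types (i j : 'I_m) (u z : seq 'I_m) (t : 'S_m.+1).

Lemma st_far i j : (i.+1 < j)%N || (j.+1 < i)%N ->
  st i (lo j) = lo j /\ st i (hi j) = hi j.
Proof.
by move=> ij; split; apply: tpermD; rewrite -val_eqE /= /bump /= ?add1n; lia.
Qed.

Lemma st_next i j : j = i.+1 :> nat ->
  [/\ hi i = lo j, st i (hi j) = hi j & st j (lo i) = lo i].
Proof.
move=> ij; split; first by apply: val_inj; rewrite /= /bump /= add1n.
all: by apply: tpermD; rewrite -val_eqE /= /bump /= ?add1n; lia.
Qed.

Lemma st_conj i j : (st i * st j * st i)%g = tperm (st i (lo j)) (st i (hi j)).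
Proof. by rewrite -tpermJ conjgE stV mulgA. Qed.

Lemma st_comm i j : (i.+1 < j)%N || (j.+1 < i)%N ->
  (st i * st j)%g = (st j * st i)%g.
Proof.
move=> ij; have := st_conj i j; have [-> ->] := st_far ij.
by move=> /(canRL (mulgK _)); rewrite stV.
Qed.

Lemma st_braid i j : j = i.+1 :> nat ->
  (st i * st j * st i)%g = (st j * st i * st j)%g.
Proof.
move=> ij; have [hilo ihi jlo] := st_next ij.
by rewrite !st_conj jlo ihi -{1}hilo /st tpermR {1}hilo tpermL.
Qed.

Lemma reduced_rcons_desc t z i : ~~ asc t i -> reduced z ->
  wperm z = (st i * t)%g ->
  reduced (rcons z i) /\ wperm (rcons z i) = t.
Proof.
move=> t_i z_red zE; rewrite reduced_rcons wperm_rcons zE -desc_asc t_i z_red.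
by rewrite mulgA stK mul1g.
Qed.

Lemma prod_rcons u i : \prod_(k <- rcons u i) T k = \prod_(k <- u) T k * T i.
Proof. by rewrite -cats1 big_cat big_seq1. Qed.

(* If the last letters i and j of two words of t differ, t has descents at both,
   hence reduced words ending in a reduced word of the longest element of the
   parabolic subgroup generated by s_i and s_j. *)
Lemma matsumoto u u' : reduced u -> reduced u' -> wperm u = wperm u' ->
  \prod_(i <- u) T i = \prod_(i <- u') T i.
Proof.
move: {2}(size u) (erefl (size u)) => k;
  elim: k u u' => [|k IHk] u u' sz_u u_red u'_red uu'.
  have := u'_red; rewrite /reduced -uu' (eqP u_red) sz_u eq_sym => /nilP->.
  by rewrite (size0nil sz_u).
have sz_u' : size u' = k.+1 by rewrite -(eqP u'_red) -uu' (eqP u_red).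
case/lastP: u sz_u u_red uu' => // u i; rewrite size_rcons => -[sz_u] u_red.
case/lastP: u' sz_u' u'_red => // u' j;
  rewrite size_rcons => -[sz_u'] u'_red uu'.
wlog le_ij : u u' i j sz_u sz_u' u_red u'_red uu' / (i <= j)%N.
  move=> wlog_le; have [le_ij|/ltnW le_ji] := leqP i j; first exact: wlog_le.
  by apply/esym/wlog_le.
rewrite !prod_rcons; have [eq_ij|lt_ij] : i = j \/ (i < j)%N.
  by move: le_ij; rewrite leq_eqVlt => /predU1P[/val_inj|]; [left | right].
- rewrite eq_ij; congr (_ * _); move: u_red u'_red uu'.
  rewrite !reduced_rcons !wperm_rcons eq_ij => /andP[u_red _] /andP[u'_red _].
  by move/mulgI; apply: IHk.
move: u_red u'_red; rewrite !reduced_rcons =>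
  /andP[u_red u_i] /andP[u'_red u'_j].
pose t := wperm (rcons u i).
have uE : wperm u = (st i * t)%g by rewrite /t wperm_rcons mulgA stK mul1g.
have u'E : wperm u' = (st j * t)%g by rewrite /t uu' wperm_rcons mulgA stK
  mul1g.
have t_i : ~~ asc t i by rewrite desc_asc -uE.
have t_j : ~~ asc t j by rewrite desc_asc -u'E.
have IHu z l : reduced (rcons z l) /\ wperm (rcons z l) = wperm u ->
    \prod_(k <- u) T k = \prod_(k <- z) T k * T l.
  by case=> z_red zE; rewrite -prod_rcons; apply: IHk.
have IHu' z l : reduced (rcons z l) /\ wperm (rcons z l) = wperm u' ->
    \prod_(k <- u') T k = \prod_(k <- z) T k * T l.
  by case=> z_red zE; rewrite -prod_rcons; apply: IHk.
have [far_ij|adj_ij] : (i.+1 < j)%N \/ j = i.+1 :> nat.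
  by move: lt_ij; rewrite leq_eqVlt => /predU1P[|]; [right | left].
- have ij : (i.+1 < j)%N || (j.+1 < i)%N by rewrite far_ij.
  have ji : (j.+1 < i)%N || (i.+1 < j)%N by rewrite orbC.
  (* Commuting case: [z] writes [t] with both final letters removed, so [u] may be replaced by [z]
     followed by [j], and [u'] by [z] followed by [i]. *)
  have [z zE z_red] := reduced_word (st j * wperm u)%g.
  rewrite (IHu z j) ?(IHu' z i) -?mulrA ?(T_comm ij) //.
  + apply: reduced_rcons_desc => //.
      by rewrite u'E /asc !permM; have [-> ->] := st_far ji.
    rewrite zE uE u'E !mulgA; congr (_ * _)%g.
    by rewrite (st_comm ij).
  + apply: reduced_rcons_desc => //.
    by rewrite uE /asc !permM; have [-> ->] := st_far ij.
have [hilo ihi jlo] := st_next adj_ij.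
have ilo : st i (lo j) = lo i by rewrite -hilo; apply: tpermR.
have jhi : st j (hi i) = hi j by rewrite hilo; apply: tpermL.
(* Braid case: [z] writes [t] with s_i s_j s_i removed, so [u] may be replaced by [z], [i], [j], and
   [u'] by [z], [j], [i]. *)
have [z zE z_red] := reduced_word (st i * (st j * wperm u))%g.
(* The entries of [t] at the three consecutive positions involved decrease, which makes each
   appended letter remove a descent. *)
have t_ij : (t (hi j) < t (lo i))%N.
  move: t_i t_j; rewrite /asc -!leqNgt hilo => le1 le2.
  have := leq_trans le2 le1; rewrite leq_eqVlt =>
    /predU1P[/val_inj/perm_inj/eqP|//].
  by rewrite -val_eqE /= /bump /=; lia.
have jjhi : st j (hi j) = lo j by apply: tpermR.
have iilo : st i (lo i) = lo j by rewrite -hilo; apply: tpermL.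
have jjlo : st j (lo j) = hi j by apply: tpermL.
have zj : reduced (rcons z i) /\ wperm (rcons z i) = (st j * wperm u)%g.
  apply: reduced_rcons_desc => //; rewrite uE /asc !permM jlo jhi iilo ihi.
  by move: t_j; rewrite /asc.
have zi : reduced (rcons z j) /\ wperm (rcons z j) = (st i * wperm u')%g.
  apply: reduced_rcons_desc => //.
    rewrite u'E /asc !permM ilo jlo ihi jjhi; move: t_i; rewrite /asc.
    by rewrite hilo.
  rewrite zE uE u'E !mulgA; congr (_ * _)%g.
  exact: st_braid.
rewrite (IHu (rcons z i) j) ?(IHu' (rcons z j) i) ?prod_rcons -?mulrA.
- by have := T_braid adj_ij; rewrite -!mulrA => ->.
- apply: reduced_rcons_desc; rewrite ?(proj1 zi) ?(proj2 zi) //.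
  by rewrite u'E /asc !permM jlo hilo jjlo -leqNgt ltnW.
- apply: reduced_rcons_desc; rewrite ?(proj1 zj) ?(proj2 zj) //.
  by rewrite uE /asc !permM ilo ihi -leqNgt ltnW.
Qed.

End Matsumoto.

(** * The basis spans *)

Section Spanning.
Variables (F : finFieldType) (m b : nat) (Fb : {group {unit F}}).
Hypothesis hFb : #|Fb| = b.
Local Notation tor := {ffun 'I_m.+1 -> {unit F}}.
Local Notation onFb := (ffun_on (mem Fb)).
Local Notation H := (heckeT m b Fb).
Local Notation c := (KLc b).
Local Notation phi := (@specialize b : {rmorphism _ -> _}).
Local Notation ex := (@ext _ _ phi _ (@hecke_rels F m b Fb)).
Local Notation Ts := (@Ts F m b Fb).
Local Notation Dt := (@Dt F m b Fb).
Local Notation Es := (@Es F m b Fb).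
Local Notation K := ('S_m.+1 * tor)%type.
Local Notation Kb := (Kmon m Fb).
Implicit Types (f d : tor) (i j : 'I_m) (t : 'S_m.+1) (u : seq 'I_m) (k : K).

Definition Tw u : H := \prod_(i <- u) Ts i.
Definition Tk k : H := Tx b Fb (gmon k).

Lemma Tw_rcons u i : Tw (rcons u i) = Tw u * Ts i.
Proof. exact: prod_rcons. Qed.

Lemma Tw_matsumoto u u' : reduced u -> reduced u' -> wperm u = wperm u' ->
  Tw u = Tw u'.
Proof.
apply: matsumoto => i j; [exact: Ts_comm | exact: Ts_braid].
Qed.

Lemma ext_prod_ts u :
  ex (\prod_(i <- u) ts b Fb i : palg _) = Av b ^+ size u *: Tw u.
Proof.
rewrite /Tw; elim: u => [|i u IHu]; first by rewrite !big_nil ext1 scale1r.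
rewrite !big_cons extM IHu ts_Ts -hecke_scaleAl -hecke_scaleAr scalerA.
by rewrite exprS.
Qed.

(** The factor v^-len in [Tx] cancels the powers of v coming from t_s = v T_s, and Matsumoto
    replaces the word chosen by [redword] with [u]. *)
Lemma TkE t d u : d \in onFb -> reduced u -> wperm u = t ->
  Tk (t, d) = Tw u * Dt d.
Proof.
move=> Fd u_red uE; have Kk : (t, d) \in Kb by rewrite inE.
have [wE w_red] := redword_perm F t.
rewrite /Tk /Tx tensorE len_gmon // /tx wpart_gmon // dpart_gmon // extM.
rewrite ext_prod_ts -(eqP w_red) wE /= -hecke_scaleAl scalerA -exprMn
  Avinv_mulr.
by rewrite expr1n scale1r; congr (_ * _); apply: Tw_matsumoto; rewrite ?wE ?uE.
Qed.

Lemma tmul_Fb f d : f \in onFb -> d \in onFb -> tmul f d \in onFb.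
Proof. by move=> /ffun_onP Ff /ffun_onP Fd; apply/ffun_onP => l;
  rewrite ffunE groupM ?Ff ?Fd. Qed.

Lemma tact_Fb t f : f \in onFb -> tact t f \in onFb.
Proof. by move=> /ffun_onP Ff; apply/ffun_onP => l; rewrite ffunE Ff. Qed.

Lemma TkD t d f : d \in onFb -> f \in onFb ->
  Tk (t, d) * Dt f = Tk (t, tmul d f).
Proof.
move=> Fd Ff; have [u uE u_red] := reduced_word t.
by rewrite !(TkE _ u_red uE) ?tmul_Fb // -mulrA DtM.
Qed.

Lemma TkTs t d i : d \in onFb ->
  Tk (t, d) * Ts i = Tk ((st i * t)%g, tact (st i) d) +
    (if asc t i then 0 else
       c *: \sum_(x in Fb) Tk (t, tmul (hx b (lo i) (hi i) x) d)).
Proof.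
move=> Fd; have [t_i|t_i] := boolP (asc t i).
  have [u uE u_red] := reduced_word t.
  have ui_red : reduced (rcons u i) by rewrite reduced_rcons u_red uE.
  rewrite addr0 (TkE Fd u_red uE) (TkE _ ui_red) ?tact_Fb ?wperm_rcons ?uE //.
  by rewrite Tw_rcons -!mulrA DtTs.
have [u uE u_red] := reduced_word (st i * t)%g.
have [ui_red uiE] := reduced_rcons_desc t_i u_red uE.
rewrite (TkE Fd ui_red uiE) (TkE _ u_red uE) ?tact_Fb // -mulrA DtTs //.
rewrite Tw_rcons -mulrA (mulrA (Ts i)) Ts_quad mulrDl mul1r mulrDr;
  congr (_ + _).
rewrite -hecke_scaleAl -hecke_scaleAr; congr (_ *: _).
(* At a descent T_s^2 leaves a term with E_s T_s; here E_s moves to the right of T_s and absorbs the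
   twist of [d]. *)
rewrite -(TsEs hFb) -mulrA (Es_tact hFb) // mulrA -Tw_rcons mulr_suml mulr_sumr.
apply: eq_bigr => x Fx.
by rewrite (TkE _ ui_red uiE) ?tmul_Fb ?hx_Fb // DtM ?hx_Fb.
Qed.

Definition spanned (h : H) : Prop :=
  exists a : K -> Atilde b, h = \sum_(k in Kb) a k *: Tk k.

Lemma spanned0 : spanned 0.
Proof. by exists (fun=> 0); rewrite big1 // => k _; rewrite scale0r. Qed.

Lemma spannedD h h' : spanned h -> spanned h' -> spanned (h + h').
Proof.
move=> [a ->] [a' ->]; exists (fun k => a k + a' k).
by rewrite -big_split; apply: eq_bigr => k _; rewrite scalerDl.
Qed.

Lemma spannedZ r h : spanned h -> spanned (r *: h).
Proof.
move=> [a ->]; exists (fun k => r * a k).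
by rewrite scaler_sumr; apply: eq_bigr => k _; rewrite scalerA.
Qed.

Lemma spanned_Tk k : k \in Kb -> spanned (Tk k).
Proof.
move=> Kk; exists (fun l => (l == k)%:R); rewrite (bigD1 k) //= eqxx scale1r.
by rewrite big1 ?addr0 // => l /andP[_ /negPf->]; rewrite scale0r.
Qed.

Lemma spanned_sum I (r : seq I) (P : pred I) (h : I -> H) :
  (forall l, P l -> spanned (h l)) -> spanned (\sum_(l <- r | P l) h l).
Proof. by move=> sp; apply: big_ind => //;
  [apply: spanned0 | apply: spannedD]. Qed.

Lemma spanned_mulr (z : H) : (forall k, k \in Kb -> spanned (Tk k * z)) ->
  forall h, spanned h -> spanned (h * z).
Proof.
move=> sp_z h [a ->]; rewrite mulr_suml; apply: spanned_sum => k Kk.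
by rewrite -hecke_scaleAl; apply/spannedZ/sp_z.
Qed.

Lemma in_Kb t d : ((t, d) \in Kb) = (d \in onFb).
Proof. by rewrite inE. Qed.

Lemma spanned_mulTs i h : spanned h -> spanned (h * Ts i).
Proof.
apply: spanned_mulr => -[t d]; rewrite in_Kb => Fd; rewrite TkTs //.
apply: spannedD; first by apply: spanned_Tk; rewrite in_Kb tact_Fb.
case: ifP => _; first exact: spanned0.
apply/spannedZ/spanned_sum => x Fx; apply: spanned_Tk.
by rewrite in_Kb tmul_Fb ?hx_Fb.
Qed.

Lemma spanned_mulDt f h : f \in onFb -> spanned h -> spanned (h * Dt f).
Proof.
move=> Ff; apply: spanned_mulr => -[t d]; rewrite in_Kb => Fd; rewrite TkD //.
by apply: spanned_Tk; rewrite in_Kb tmul_Fb.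
Qed.

Lemma one_Fb : ([ffun=> 1%g] : tor) \in onFb.
Proof. by apply/ffun_onP => l; rewrite ffunE group1. Qed.

Lemma Tk1 : Tk (1%g, [ffun=> 1%g]) = 1.
Proof.
rewrite (@TkE _ _ [::]) ?one_Fb /reduced ?ninv1 //.
by rewrite /Tw big_nil mul1r Dt1.
Qed.

Lemma spanned_all h : spanned h.
Proof.
rewrite -[h]mul1r; have : spanned 1.
  by rewrite -Tk1; apply: spanned_Tk; rewrite in_Kb one_Fb.
(* Replacing 1 by an arbitrary spanned [z] lets the induction pass through products. The outer
   induction is over the extended algebra, the inner one over the algebra before extension. *)
move: 1; elim/palg_elim: h => [[r h]|||x IH|x y IHx IHy|x y IHx IHy|r x IH] z
  sp_z.
- rewrite -[palg_gen _ _]/(tensor phi r h) tensorE -hecke_scaleAr;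
  apply: spannedZ.
  elim/palg_elim: h z sp_z => {r} [[i|d]|||x IH|x y IHx IHy|x y IHx IHy|r x IH]
    z sp_z.
  + rewrite -[palg_gen _ _]/(ts b Fb i) ts_Ts -hecke_scaleAr.
    exact/spannedZ/spanned_mulTs.
  + have /imsetP[f Ff dE] := subgP d.
    rewrite -(sgvalK d) dE; exact: (spanned_mulDt Ff sp_z).
  + by rewrite ext0 mulr0; apply: spanned0.
  + by rewrite ext1 mulr1.
  + by rewrite -scaleN1r extZ rmorphN1 -hecke_scaleAr; apply/spannedZ/IH.
  + by rewrite extD mulrDr; apply: spannedD; [apply: IHx | apply: IHy].
  + by rewrite extM mulrA; apply/IHy/IHx.
  + by rewrite extZ -hecke_scaleAr; apply/spannedZ/IH.
- by rewrite mulr0; apply: spanned0.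
- by rewrite mulr1.
- by rewrite -scaleN1r -hecke_scaleAr; apply/spannedZ/IH.
- by rewrite mulrDr; apply: spannedD; [apply: IHx | apply: IHy].
- by rewrite mulrA; apply/IHy/IHx.
- by rewrite -hecke_scaleAr; apply/spannedZ/IH.
Qed.

End Spanning.

(** * The right regular representation *)

Section LocalBraid.
Variables (R : comNzRingType) (K : finType) (v c : R).
Local Notation M := {ffun K -> R^o}.

Lemma ffunDE (f g : M) k : (f + g) k = (f k : R) + g k.
Proof. by rewrite ffunE. Qed.
Lemma ffunZE a (f : M) k : (a *: f) k = (a : R) * f k.
Proof. by rewrite ffunE. Qed.

(** The shape of the operator of t_s = v T_s. Products are expanded below in powers of [c], so that
    relations can be compared coefficient by coefficient. *)
Definition qop (P X : M -> M) (f : M) : M := v *: (P f + c *: X f).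

Lemma qop3E (P X Q Y : {linear M -> M}) (f : M) k :
  qop P X (qop Q Y (qop P X f)) k = v ^+ 3 *
    (P (Q (P f)) k + c * ((P (Q (X f))) k + P (Y (P f)) k + X (Q (P f)) k) +
     c ^+ 2 * (P (Y (X f)) k + X (Q (X f)) k + X (Y (P f)) k) +
     c ^+ 3 * X (Y (X f)) k : R).
Proof.
rewrite /qop !(linearZ, linearD, scalerDr, ffunDE, ffunZE) /=.
by ring.
Qed.

Lemma qop2E (P X Q Y : {linear M -> M}) (f : M) k :
  qop P X (qop Q Y f) k = v ^+ 2 *
    (P (Q f) k + c * (P (Y f) k + X (Q f) k) + c ^+ 2 * X (Y f) k : R).
Proof.
rewrite /qop !(linearZ, linearD, scalerDr, ffunDE, ffunZE) /=.
by ring.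
Qed.
End LocalBraid.

(** * Operators on functions on pairs, and their braid and quadratic relations *)

Section Operators.
Variables (R : comNzRingType) (F : finFieldType) (m b : nat).
Variable Fb : {group {unit F}}.
Hypothesis hFb : #|Fb| = b.
Local Notation tor := {ffun 'I_m.+1 -> {unit F}}.
Local Notation onFb := (ffun_on (mem Fb)).
Local Notation K := ('S_m.+1 * tor)%type.
Local Notation M := {ffun K -> R^o}.
Local Notation n := m.+1.
Implicit Types (t s : 'S_m.+1) (j k l : 'I_n) (g : M) (f d : tor).

Definition opP t g : M := [ffun p => g ((t * p.1)%g, tact t p.2)].
Definition opD d g : M := [ffun p => g (p.1, tmul (tinv d) p.2)].
Definition opE j k g : M :=
  [ffun p => \sum_(x in Fb) g (p.1, tmul (hx b j k x) p.2)].
(** Arbitrary pairs of positions are allowed, in either order, because moving a permutation operator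
    past [opX] permutes the two positions ([opPX]). *)
Definition desc j k (p : K) : R := ((p.1 k < p.1 j)%N)%:R.
Definition opX j k g : M := [ffun p => desc j k p * opE j k g p].

Fact opP_linear t : linear (opP t).
Proof. by move=> a g h; apply/ffunP => p; rewrite !ffunE. Qed.
HB.instance Definition _ t := GRing.isLinear.Build R M M _
  (opP t) (opP_linear t).

Fact opD_linear d : linear (opD d).
Proof. by move=> a g h; apply/ffunP => p; rewrite !ffunE. Qed.
HB.instance Definition _ d := GRing.isLinear.Build R M M _
  (opD d) (opD_linear d).

Fact opE_linear j k : linear (opE j k).
Proof.
move=> a g h; apply/ffunP => p; rewrite !ffunE scaler_sumr -big_split.
by apply: eq_bigr => x _; rewrite !ffunE.
Qed.
HB.instance Definition _ j k := GRing.isLinear.Build R M M _ (opE j k)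
  (opE_linear j k).

Lemma opXE j k g p : opX j k g p = desc j k p * (opE j k g p : R).
Proof. by rewrite ffunE. Qed.

Fact opX_linear j k : linear (opX j k).
Proof.
move=> a g h; apply/ffunP => p; rewrite ffunDE ffunZE !opXE linearP.
by rewrite ffunDE ffunZE mulrDr mulrCA.
Qed.
HB.instance Definition _ j k := GRing.isLinear.Build R M M _ (opX j k)
  (opX_linear j k).

Lemma tact_comp t s f : tact t (tact s f) = tact (t * s)%g f.
Proof. by apply/ffunP => j; rewrite !ffunE permM. Qed.

Lemma tact1 f : tact 1%g f = f.
Proof. by apply/ffunP => j; rewrite !ffunE perm1. Qed.

Lemma tact_mul t f d : tact t (tmul f d) = tmul (tact t f) (tact t d).
Proof. by apply/ffunP => j; rewrite !ffunE. Qed.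

Lemma tmulA : associative (@tmul F m).
Proof. by move=> f d e; apply/ffunP => j; rewrite !ffunE mulgA. Qed.

Lemma tmulC : commutative (@tmul F m).
Proof. by move=> f d; apply/ffunP => j; rewrite !ffunE unitC. Qed.

Lemma opPP t s g : opP t (opP s g) = opP (s * t)%g g.
Proof.
by apply/ffunP => -[p f]; rewrite !ffunE /= mulgA tact_comp.
Qed.

Lemma opP1 g : opP 1 g = g.
Proof. by apply/ffunP => -[p f]; rewrite !ffunE /= mul1g tact1. Qed.

Lemma opPX t j k g : opP t (opX j k g) = opX (t j) (t k) (opP t g).
Proof.
apply/ffunP => -[p f]; rewrite !ffunE /desc /= !permM; congr (_ * _).
by apply: eq_bigr => x _; rewrite !ffunE /= tact_mul tact_hx !permK.
Qed.

Lemma opEC j k g : j != k -> opE j k g = opE k j g.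
Proof.
move=> jk; apply/ffunP => -[p f]; rewrite !ffunE /= -[LHS](sum_epsV hFb).
by apply: eq_bigr => x _; rewrite hxC.
Qed.

Lemma opEE j k j' k' g : opE j k (opE j' k' g) = opE j' k' (opE j k g).
Proof.
apply/ffunP => -[p f]; rewrite !ffunE.
under eq_bigr do rewrite ffunE; rewrite exchange_big /=.
apply: eq_bigr => y _; rewrite ffunE; apply: eq_bigr => x _ /=.
by rewrite !tmulA [tmul (hx _ j' _ _) _]tmulC.
Qed.

Lemma opEXE j k j' k' g p :
  opE j k (opX j' k' g) p = desc j' k' p * (opE j k (opE j' k' g) p : R).
Proof. by rewrite !ffunE mulr_sumr; apply: eq_bigr => x _; rewrite !ffunE. Qed.

Lemma descM j k p : desc j k p * desc j k p = desc j k p.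
Proof. by rewrite /desc -natrM mulnb andbb. Qed.

Lemma opXXE j k j' k' g p :
  opX j k (opX j' k' g) p =
  desc j k p * desc j' k' p * (opE j k (opE j' k' g) p : R).
Proof. by rewrite opXE opEXE mulrA. Qed.

Lemma opEX j k j' k' g : opE j k (opX j' k' g) = opX j' k' (opE j k g).
Proof. by apply/ffunP => p; rewrite opEXE opXE opEE. Qed.

Lemma opXXXE j k j' k' j'' k'' g p :
  opX j k (opX j' k' (opX j'' k'' g)) p =
  desc j k p * desc j' k' p * desc j'' k'' p *
    (opE j k (opE j' k' (opE j'' k'' g)) p : R).
Proof. by rewrite opXXE !opEX opXE mulrA ![opE j'' k'' _]opEE. Qed.

Lemma opE_merge j k l g : j != k -> j != l -> k != l ->
  opE j k (opE k l g) = opE j k (opE j l g).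
Proof.
move=> jk jl kl; apply/ffunP => -[p f]; rewrite !ffunE.
under eq_bigr do rewrite ffunE; under [RHS]eq_bigr do rewrite ffunE.
rewrite exchange_big [RHS]exchange_big /=; apply: eq_bigr => y Fy.
rewrite (reindex_inj (mulIg y)) /=.
apply: eq_big => [x|x Fx]; first by rewrite groupMr.
congr (g (_, _)); rewrite !tmulA; congr tmul; apply/ffunP => i; rewrite !ffunE.
have [->|i_j] := eqVneq i j; first by rewrite (negPf jk) (negPf jl) mul1g unitC.
have [->|i_k] := eqVneq i k; last by [].
by rewrite (negPf kl) mul1g invMg [LHS]unitC -!mulgA [(x^-1 * y)%g]unitC mulKg.
Qed.

Lemma opPE t j k g : opP t (opE j k g) = opE (t j) (t k) (opP t g).
Proof.
apply/ffunP => -[p f]; rewrite !ffunE; apply: eq_bigr => x _.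
by rewrite !ffunE /= tact_mul tact_hx !permK.
Qed.

Lemma desc_sum j k p : j != k -> desc j k p + desc k j p = 1.
Proof.
move=> jk; rewrite /desc; have : p.1 j != p.1 k :> nat.
  by rewrite (inj_eq val_inj) (inj_eq perm_inj).
by case: ltngtP => // _ _; rewrite ?addr0 ?add0r.
Qed.

Variables (v c : R).
Definition opS (i : 'I_m) : M -> M := qop v c (opP (st i)) (opX (lo i) (hi i)).

Lemma opS_linear i : linear (opS i).
Proof.
move=> a g h; apply/ffunP => p; rewrite /opS /qop !(linearP, linearZ, ffunDE,
  ffunZE) /=.
by ring.
Qed.

(** Moving P past X reverses the descent indicator, so P X + X P = E P because the two indicators
    sum to 1; and X X = X E because an indicator is idempotent. *)
Lemma opS_quad i g : opS i (opS i g) =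
  v ^+ 2 *: g + (v * c) *: opS i (opE (lo i) (hi i) g).
Proof.
have ne_i := lo_neq_hi i; apply/ffunP => p;
  rewrite /opS qop2E !(ffunDE, ffunZE).
rewrite /= opPP stK opP1 opPX opPE tpermL tpermR (opEC _ (_ : hi i != lo i));
  last by rewrite eq_sym.
rewrite !opXE -(opEC _ ne_i) opEXE [desc _ _ p * (desc _ _ p * _)]mulrA descM.
by rewrite -[desc (hi i) _ p](addrK (desc (lo i) (hi i) p)) addrC desc_sum
  1?eq_sym //; ring.
Qed.

Lemma opS_comm (i j : 'I_m) g : (i.+1 < j)%N || (j.+1 < i)%N ->
  opS i (opS j g) = opS j (opS i g).
Proof.
move=> ij; apply/ffunP => p; rewrite /opS [LHS]qop2E [RHS]qop2E /=;
  have ji : (j.+1 < i)%N || (i.+1 < j)%N by rewrite orbC.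
rewrite !opPP (st_comm ij) !opPX; have [-> ->] := st_far ij;
  have [-> ->] := st_far ji.
rewrite !opXXE opEE; ring.
Qed.

Lemma opS_braid (i j : 'I_m) g : j = i.+1 :> nat ->
  opS i (opS j (opS i g)) = opS j (opS i (opS j g)).
Proof.
move=> ij; apply/ffunP => p; rewrite /opS [LHS]qop3E [RHS]qop3E /=.
have [hilo ihi jlo] := st_next ij.
have ilo : st i (hi i) = lo i by apply: tpermR.
have ihi' : st i (lo i) = hi i by apply: tpermL.
have jhi : st j (hi i) = hi j by rewrite hilo; apply: tpermL.
have jlo' : st j (hi j) = hi i by rewrite hilo; apply: tpermR.
have lohi := lo_neq_hi i.
have hihi : hi i != hi j by rewrite hilo lo_neq_hi.
have lohi' : lo i != hi j by rewrite -val_eqE /= /bump /=; lia.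
rewrite -hilo; set x := lo i in lohi lohi' ilo ihi' jlo *.
set y := hi i in hihi lohi ilo ihi' jhi jlo' *;
  set z := hi j in hihi lohi' ihi jhi jlo' *.
rewrite !opPX !(ihi, jlo, ilo, ihi', jhi, jlo', opPX).
have [neyx nezx nezy] : [/\ y != x, z != x & z != y] by rewrite ![_ == x]eq_sym
  [z == y]eq_sym.
(* Consequences of [opE_merge] and symmetry: every product of two of the operators E that occurs
   equals E_xy E_yz. *)
have e2 h : opE x y (opE x z h) = opE x y (opE y z h) by rewrite -opE_merge.
have e1 h : opE x z (opE y x h) = opE x y (opE y z h) by rewrite [opE y x
  _]opEC // opEE e2.
have e3 h : opE x z (opE z y h) = opE x y (opE y z h) by rewrite opE_merge //
  opEE e2.
have e4 h : opE y z (opE x z h) = opE x y (opE y z h).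
  by rewrite [opE x z _]opEC // [LHS]opEC // -opE_merge // [opE y x _]opEC //
    opEE [opE z y _]opEC.
have e5 h : opE y z (opE x y h) = opE x y (opE y z h) by rewrite opEE.
have e6 : opE y z (opE x y (opE y z g)) = opE x y (opE y z (opE x y g)).
  by rewrite -e2 opEE e4 e5.
rewrite !opXXXE e6 !opXXE e1 e2 e3 e4 !e5 !opPP !mulgA !stK !opP1 (st_braid ij).
(* These identities match the coefficients of c^2 attached to P_i and to P_j respectively; they are
   checked on the possible orders of the three values. *)
have [d1 d2] :
    desc y z p * desc x z p =
      desc x z p * desc y x p + desc x y p * desc y z p /\
    desc x y p * desc x z p =
      desc x z p * desc z y p + desc y z p * desc x y p.
  rewrite /desc; have inj_p (j1 j2 : 'I_n) : j1 != j2 ->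
    p.1 j1 != p.1 j2 :> nat.
    by move=> ne12; rewrite (inj_eq val_inj) (inj_eq perm_inj).
  move: (inj_p _ _ lohi) (inj_p _ _ lohi') (inj_p _ _ hihi).
  set px := (p.1 x : nat); set py := (p.1 y : nat); set pz := (p.1 z : nat).
  case: (ltngtP px py) => // xy _; case: (ltngtP px pz) => // xz _;
    case: (ltngtP py pz) => // yz _; rewrite ?mulr0 ?mul0r ?mulr1 ?mul1r ?addr0
      ?add0r //; exfalso; lia.
rewrite d1 d2 (mulrAC (desc x y p) (desc y z p) (desc x y p))
  (mulrAC (desc y z p) (desc x y p) (desc y z p)) !descM.
ring.
Qed.

End Operators.

(** * The action of the Hecke algebra and the coordinate functions it provides *)

Section Representation.
Variables (F : finFieldType) (m b : nat) (Fb : {group {unit F}}).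
Hypothesis hFb : #|Fb| = b.
Local Notation tor := {ffun 'I_m.+1 -> {unit F}}.
Local Notation onFb := (ffun_on (mem Fb)).
Local Notation K := ('S_m.+1 * tor)%type.
Local Notation R := (Atilde b).
Local Notation M := {ffun K -> R^o}.
Local Notation H := (heckeT m b Fb).
Local Notation c := (KLc b).
Local Notation v := (Av b).
Local Notation phi := (@specialize b : {rmorphism _ -> _}).
Local Notation ex := (@ext _ _ phi _ (@hecke_rels F m b Fb)).
Local Notation Ts := (@Ts F m b Fb).
Local Notation Dt := (@Dt F m b Fb).
Local Notation Tk := (@Tk F m b Fb).
Local Notation Tw := (@Tw F m b Fb).
Local Notation Kb := (Kmon m Fb).
Local Notation opS := (@opS (Atilde b) F m b Fb v c).
Local Notation opX := (@opX (Atilde b) F m b Fb).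
Local Notation opE := (@opE (Atilde b) F m b Fb).
Local Notation opP := (@opP (Atilde b) F m).
Local Notation opD := (@opD (Atilde b) F m).
Implicit Types (f d : tor) (i j : 'I_m) (t : 'S_m.+1) (g : M) (k p : K).

Lemma tact_tinv t d : tact t (tinv d) = tinv (tact t d).
Proof. by apply/ffunP => j; rewrite !ffunE. Qed.

Lemma opSD i d g : d \in onFb -> opS i (opD d g) =
  opD (tact (st i) d) (opS i g).
Proof.
move=> Fd; have opD_qop e x y : opD e (v *: (x + c *: y)) =
  v *: (opD e x + c *: opD e y).
  by apply/ffunP => p; rewrite !ffunE.
rewrite /opS /qop opD_qop; congr (_ *: (_ + _ *: _)).
  apply/ffunP => -[p f]; rewrite !ffunE /= tact_mul tact_tinv tact_comp.
  by rewrite stK tact1.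
apply/ffunP => -[p f]; rewrite !ffunE /=; congr (_ * _).
under eq_bigr do rewrite ffunE /=.
have Fd' : tinv d \in onFb by apply/ffun_onP => l;
  rewrite ffunE groupV (ffun_onP Fd).
under [RHS]eq_bigr do rewrite tmulA -tact_tinv.
rewrite (sum_hx_tact b i (fun e => g (p, tmul e f)) Fd').
by apply: eq_bigr => x _; rewrite tmulA [tmul (tinv d) _]tmulC.
Qed.

(** Translation by [opD d] uses d^-1, so the sum is reindexed by inversion, with eps^-1 = eps. *)
Lemma sum_opD (j k : 'I_m.+1) g : \sum_(x in Fb) opD (hx b j k x) g = opE j k g.
Proof.
apply/ffunP => p; rewrite sum_ffunE !ffunE (reindex_inj invg_inj) /=.
apply: eq_big => [x|x Fx]; first by rewrite groupV.
rewrite ffunE; congr (g (_, tmul _ _)); apply/ffunP => l; rewrite !ffunE invgK.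
have epsV : (eps F b)^-1%g = eps F b.
  by apply: (mulgI (eps F b)); rewrite mulgV eps2.
case: ifP => _; first by rewrite invgK.
by case: ifP => _; rewrite ?invg1 // invMg epsV unitC.
Qed.

Definition tor_of (x : {'GL_m.+1[F]}) : tor :=
  odflt [ffun=> 1%g] [pick f | diagGL f == x].

Lemma diagGLK : cancel (@diagGL F m) tor_of.
Proof.
move=> f; rewrite /tor_of; case: pickP => [d /eqP/diagGL_inj //|/(_ f)].
by rewrite eqxx.
Qed.

Definition gen_op (x : 'I_m + subg_of (Hdiag_group m Fb)) : M -> M :=
  match x with inl i => opS i | inr d => opD (tor_of (sgval d)) end.

Lemma gen_op_linear x : linear (gen_op x).
Proof. by case: x => [i|d] a g h /=; [apply: opS_linear | apply: linearP]. Qed.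

Lemma tor_of_subg f : f \in onFb ->
  tor_of (sgval (subg (Hdiag_group m Fb) (diagGL f))) = f.
Proof. by move=> Ff; rewrite subgK ?mem_Hdiag // diagGLK. Qed.

Lemma mem_HdiagP (d : {'GL_m.+1[F]}) :
  d \in Hdiag m Fb -> exists2 f, f \in onFb & d = diagGL f.
Proof. by case/imsetP=> f; exists f. Qed.

Lemma opD_M f d g : opD d (opD f g) = opD (tmul f d) g.
Proof.
apply/ffunP => -[p e]; rewrite !ffunE /= tmulA; congr (g (_, tmul _ _)).
by apply/ffunP => l; rewrite !ffunE invMg unitC.
Qed.

Lemma gen_op_rels x y : @hecke_rels F m b Fb x y ->
  interp phi gen_op x =1 interp phi gen_op y.
Proof.
case=> {x y}.
- move=> g /=; rewrite -(diagGL1 F m) tor_of_subg ?one_Fb //.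
  apply/ffunP => -[p e]; rewrite !ffunE /=; congr (g (_, _)).
  by apply/ffunP => l; rewrite !ffunE invg1 mul1g.
- move=> _ _ /mem_HdiagP[f Ff ->] /mem_HdiagP[d Fd ->] g /=.
  by rewrite diagGLM !tor_of_subg ?tmul_Fb // opD_M.
- move=> _ i /mem_HdiagP[f Ff ->] g /=.
  rewrite -mulgA diag_sgen mulgA sgenE -permGLM stK permGL1 mul1g.
  by rewrite !tor_of_subg ?tact_Fb // opSD.
- by move=> i j ij g /=; apply/esym/opS_comm.
- by move=> i j ij g /=; apply: opS_braid.
- move=> i g /=; rewrite (opS_quad hFb) rmorphXn /= specialize_v specialize_a.
  congr (_ + _).
  rewrite (big_morph (fun z => interp phi gen_op z g) (id1 := 0) (op1 := +%R))
    //=.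
  rewrite sum_Xs.
  rewrite (eq_bigr (fun x => opS i (opD (hx b (lo i) (hi i) x) g))); last first.
    by move=> x Fx; rewrite tor_of_subg ?hx_Fb.
  rewrite -(sum_opD (lo i) (hi i)).
  have opSm : {morph opS i : x y / x + y} by move=> x y;
    have := @opS_linear (Atilde b) F m b Fb v c i 1 x y; rewrite !scale1r.
  have opS0 : opS i 0 = 0 by apply: (addIr (opS i 0)); rewrite -opSm !add0r.
  rewrite (big_morph _ opSm opS0); congr (_ *: _).
  (* The image (v^2 - 1)/b of the parameter a equals v c. *)
  by rewrite /KLc mulrCA mulrBr [v * Avinv b]mulrC Avinv_mulr expr2.
Qed.

Definition ev1 : M := [ffun p => (p == (1%g, [ffun=> 1%g]))%:R].
(** The image of the delta function at 1 under [h]; it turns out to be the coordinate function of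
    [h] in the basis ([ev_expand]). *)
Definition ev (h : H) : M := ext_act gen_op h ev1.

Lemma evD h h' : ev (h + h') = ev h + ev h'.
Proof. exact: (ext_actDl gen_op_linear gen_op_rels). Qed.

Lemma evZ r h : ev (r *: h) = r *: ev h.
Proof. exact: (ext_actZl gen_op_linear gen_op_rels). Qed.

Lemma ev_one : ev 1 = ev1.
Proof. exact: (ext_act1 gen_op_linear gen_op_rels). Qed.

Lemma ev_Ts h i :
  ev (h * Ts i) = opP (st i) (ev h) + c *: opX (lo i) (hi i) (ev h).
Proof.
rewrite -hecke_scaleAr evZ /ev (ext_actM gen_op_linear gen_op_rels).
rewrite (ext_act_gen gen_op_linear gen_op_rels) /= scalerA Avinv_mulr scale1r.
by [].
Qed.

Lemma ev_Dt h d : d \in onFb -> ev (h * Dt d) = opD d (ev h).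
Proof.
move=> Fd; rewrite /ev (ext_actM gen_op_linear gen_op_rels).
by rewrite (ext_act_gen gen_op_linear gen_op_rels) /= tor_of_subg.
Qed.

Definition edelta k : M := [ffun p => (p == k)%:R].

Lemma ev_Tw u : reduced u -> ev (Tw u) = edelta (wperm u, [ffun=> 1%g]).
Proof.
elim/last_ind: u => [_|u i IHu]; first by rewrite /Tw big_nil ev_one.
rewrite reduced_rcons => /andP[u_red u_i]; rewrite Tw_rcons ev_Ts IHu //.
rewrite wperm_rcons; apply/ffunP => -[p e]; rewrite !ffunE /= !xpair_eqE.
(* The sum in the X-term can be nonzero only over the permutation [wperm u], where [i] is an ascent
   and the indicator vanishes. *)
rewrite (_ : desc _ _ _ _ * _ = 0); last first.
  have [->|ne_pu] := eqVneq p (wperm u).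
    by rewrite /desc /= ltnNge (ltnW u_i) mul0r.
  by rewrite big1 ?mulr0 // => x _; rewrite ffunE xpair_eqE (negPf ne_pu).
rewrite scaler0 addr0 -(inj_eq (mulgI (st i))) mulgA stK mul1g.
have tact_inj : injective (@tact F m (st i)).
  by apply: inv_inj => f; rewrite tact_comp stK tact1.
rewrite -[e == _](inj_eq tact_inj); congr (_ && (_ == _))%:R.
by apply/ffunP => l; rewrite !ffunE.
Qed.

Lemma ev_Tk k : k \in Kb -> ev (Tk k) = edelta k.
Proof.
case: k => t d; rewrite in_Kb => Fd; have [u uE u_red] := reduced_word t.
rewrite (TkE b Fd u_red uE) ev_Dt // ev_Tw // uE.
apply/ffunP => -[p e]; rewrite !ffunE /= !xpair_eqE; congr (_ && _)%:R.
apply/eqP/eqP => [/ffunP ed|->]; apply/ffunP => l.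
  by have := ed l; rewrite !ffunE => /(canRL (mulKg _)); rewrite invgK mulg1.
by rewrite !ffunE mulVg.
Qed.

End Representation.

(** * The bar involution of the Hecke algebra *)

Section BarInvolution.
Variables (F : finFieldType) (m b : nat) (Fb : {group {unit F}}).
Hypothesis hFb : #|Fb| = b.
Local Notation tor := {ffun 'I_m.+1 -> {unit F}}.
Local Notation onFb := (ffun_on (mem Fb)).
Local Notation K := ('S_m.+1 * tor)%type.
Local Notation H := (heckeT m b Fb).
Local Notation c := (KLc b).
Local Notation Ts := (@Ts F m b Fb).
Local Notation Dt := (@Dt F m b Fb).
Local Notation Es := (@Es F m b Fb).
Local Notation Tk := (@Tk F m b Fb).
Local Notation Tw := (@Tw F m b Fb).
Local Notation ev := (@ev F m b Fb).
Local Notation Kb := (Kmon m Fb).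
Local Notation bar := (@hbar F m b Fb).
Implicit Types (f d : tor) (i j : 'I_m) (t : 'S_m.+1) (k p : K) (u : seq 'I_m)
  (h : H).

Lemma ev_sum I (r : seq I) (P : pred I) (h : I -> H) :
  ev (\sum_(x <- r | P x) h x) = \sum_(x <- r | P x) ev (h x).
Proof.
apply: (big_morph ev); first exact: (evD hFb).
by apply: (addIr (ev 0)); rewrite -(evD hFb) !add0r.
Qed.

Lemma ev_TkE k p : k \in Kb -> p \in Kb -> ev (Tk k) p = (p == k)%:R.
Proof. by move=> Kk _; rewrite ev_Tk ?ffunE. Qed.

Lemma ev_comb (a : K -> Atilde b) p : p \in Kb ->
  ev (\sum_(k in Kb) a k *: Tk k) p = a p.
Proof.
move=> Kp; rewrite ev_sum sum_ffunE (bigD1 p) //= (evZ hFb) ffunE ev_TkE //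
  eqxx.
rewrite big1 => [|k /andP[Kk /negPf nkp]];
  first by rewrite addr0 /GRing.scale /= mulr1.
by rewrite (evZ hFb) ffunE ev_TkE // eq_sym nkp scaler0.
Qed.

Lemma ev_expand h : h = \sum_(k in Kb) ev h k *: Tk k.
Proof.
have [a hE] := spanned_all hFb h; rewrite {1}hE; apply: eq_bigr => k Kk.
by rewrite hE ev_comb.
Qed.

Lemma sum_WHb (V : nmodType) (phi : {'GL_m.+1[F]} -> V) :
  \sum_(x in WHb m Fb) phi x = \sum_(k in Kb) phi (gmon k).
Proof. by rewrite WHbE big_imset //; apply: gmon_inj. Qed.

Lemma coord_gmon h k : k \in Kb -> Defs.coord h (gmon k) = ev h k.
Proof.
move=> Kk; rewrite /Defs.coord; case: xgetP => [a _ hE|no_a].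
  by rewrite [in RHS]hE sum_WHb ev_comb.
(* The default of [xget] is excluded: [ev h] transported along [gmon] is an admissible family. *)
pose a : {ffun {'GL_m.+1[F]} -> Atilde b} :=
  [ffun x => if [pick l in Kb | gmon l == x] is Some l then ev h l else 0].
case: (no_a a); rewrite /= sum_WHb [LHS]ev_expand; apply: eq_bigr => l Kl.
rewrite ffunE; case: pickP => [l' /andP[Kl' /eqP/(gmon_inj Kl' Kl)->] //|/(_
  l)].
by rewrite Kl eqxx.
Qed.

Definition Bk k : H := hinv (Tx b Fb (gmon k)^-1%g).

Lemma barE h : bar h = \sum_(k in Kb) Abar (ev h k) *: Bk k.
Proof. by rewrite /hbar sum_WHb; apply: eq_bigr => k Kk;
  rewrite coord_gmon. Qed.

Lemma bar_add : {morph bar : g h / g + h}.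
Proof.
move=> g h; rewrite !barE -big_split; apply: eq_bigr => k _.
by rewrite (evD hFb) ffunDE rmorphD scalerDl.
Qed.

Lemma bar_scale r h : bar (r *: h) = Abar r *: bar h.
Proof.
rewrite !barE scaler_sumr; apply: eq_bigr => k _.
by rewrite (evZ hFb) ffunZE rmorphM scalerA.
Qed.

Lemma bar_0 : bar 0 = 0.
Proof. by rewrite -(scale0r (0 : H)) bar_scale rmorph0 !scale0r. Qed.

Lemma bar_sum I (r : seq I) (P : pred I) (h : I -> H) :
  bar (\sum_(x <- r | P x) h x) = \sum_(x <- r | P x) bar (h x).
Proof. exact: (big_morph bar bar_add bar_0). Qed.

Lemma bar_Tk k : k \in Kb -> bar (Tk k) = Bk k.
Proof.
move=> Kk; rewrite barE (bigD1 k) //= ev_TkE // eqxx rmorph1 scale1r.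
rewrite big1 ?addr0 // => l /andP[Kl /negPf nlk].
by rewrite ev_TkE // nlk rmorph0 scale0r.
Qed.

Lemma bar_mulr (z z' : H) : {in Kb, forall k, bar (Tk k * z) = Bk k * z'} ->
  forall h, bar (h * z) = bar h * z'.
Proof.
move=> zz' h; rewrite [h]ev_expand mulr_suml !bar_sum mulr_suml.
apply: eq_bigr => k Kk; rewrite -hecke_scaleAl !bar_scale -hecke_scaleAl.
by rewrite zz' // bar_Tk.
Qed.

Definition Tsi i : H := Ts i - c *: Es i.
Definition Tiw u : H := \prod_(i <- u) Tsi i.

Lemma Tiw_rcons u i : Tiw (rcons u i) = Tiw u * Tsi i.
Proof. exact: prod_rcons. Qed.

Lemma TsK i : Ts i * Tsi i = 1.
Proof.
by rewrite mulrBr Ts_quad -(hecke_scaleAr c) (TsEs hFb) addrK.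
Qed.

Lemma TsiK i : Tsi i * Ts i = 1.
Proof. by rewrite mulrBl Ts_quad -(hecke_scaleAl c) addrK. Qed.

Lemma Tsi_quad i : Tsi i * Tsi i = 1 - c *: (Tsi i * Es i).
Proof. by rewrite {2}/Tsi mulrBr TsiK -(hecke_scaleAr c). Qed.

Lemma DtTsi f i : f \in onFb -> Dt f * Tsi i = Tsi i * Dt (tact (st i) f).
Proof.
move=> Ff; rewrite mulrBr mulrBl DtTs // -(hecke_scaleAl c) -(hecke_scaleAr c).
by rewrite (Es_tact hFb) // EsDt.
Qed.

Lemma DtTw f u : f \in onFb -> Dt f * Tw u = Tw u * Dt (tact (wperm u) f).
Proof.
move=> Ff; elim/last_ind: u => [|u i IHu].
  by rewrite /Tw big_nil mulr1 mul1r tact1.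
by rewrite Tw_rcons mulrA IHu -!mulrA DtTs ?tact_Fb // tact_comp wperm_rcons.
Qed.

Lemma Tiw_rev u : Tiw u * Tw (rev u) = 1.
Proof.
elim/last_ind: u => [|u i IHu]; first by rewrite /Tiw /Tw !big_nil mul1r.
by rewrite rev_rcons Tiw_rcons /Tw big_cons mulrA -(mulrA (Tiw u)) TsiK mulr1.
Qed.

Lemma rev_Tiw u : Tw (rev u) * Tiw u = 1.
Proof.
elim: u => [|i u IHu]; first by rewrite /Tiw /Tw !big_nil mul1r.
rewrite rev_cons Tw_rcons /Tiw big_cons mulrA -(mulrA (Tw _)) TsK mulr1.
exact: IHu.
Qed.

Lemma hinvE (h h' : H) : h' * h = 1 -> h * h' = 1 -> hinv h = h'.
Proof.
move=> h'h hh'; rewrite /hinv; case: xgetP => [g _ [gh hg]|/(_ h')[]//].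
by rewrite -[g]mulr1 -hh' mulrA gh mul1r.
Qed.

Lemma tinv_Fb d : d \in onFb -> tinv d \in onFb.
Proof. by move=> /ffun_onP Fd; apply/ffun_onP => l;
  rewrite ffunE groupV Fd. Qed.

Lemma tmulV d : tmul d (tinv d) = [ffun=> 1%g].
Proof. by apply/ffunP => l; rewrite !ffunE mulgV. Qed.

Lemma gmonV t d : ((gmon (t, d))^-1 = gmon (t^-1, tact t^-1 (tinv d)))%g.
Proof.
rewrite /gmon /= invgK -diag_perm invMg; congr (_ * _)%g.
  by apply: (mulgI (diagGL d)); rewrite mulgV diagGLM tmulV diagGL1.
by apply: (mulgI (permGL F t^-1)); rewrite mulgV -permGLM mulVg permGL1.
Qed.

(** The inverse group element is written by the reversed word, with the torus part twisted;
    inverting the corresponding product of T_s restores the order of [u], now with each T_s replaced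
    by its inverse. *)
Lemma BkE t d u : d \in onFb -> reduced u -> wperm u = t ->
  Bk (t, d) = Tiw u * Dt d.
Proof.
move=> Fd u_red uE; rewrite /Bk gmonV -/(Tk _).
have ru_red := reduced_rev u_red.
have ruE : wperm (rev u) = t^-1%g by rewrite wperm_rev uE.
rewrite (TkE b _ ru_red ruE) ?tact_Fb ?tinv_Fb // -ruE -DtTw ?tinv_Fb //.
have dd : Dt d * Dt (tinv d) = 1 by rewrite DtM ?tinv_Fb // tmulV Dt1.
have dd' : Dt (tinv d) * Dt d = 1 by rewrite DtM ?tinv_Fb // tmulC tmulV Dt1.
apply: hinvE.
  by rewrite mulrA -(mulrA (Tiw u)) dd mulr1 Tiw_rev.
by rewrite mulrA -(mulrA (Dt _)) rev_Tiw mulr1 dd'.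
Qed.

Lemma bar_mulDt f h : f \in onFb -> bar (h * Dt f) = bar h * Dt f.
Proof.
move=> Ff; apply: bar_mulr => -[t d]; rewrite in_Kb => Fd.
have [u uE u_red] := reduced_word t.
rewrite TkD // bar_Tk ?in_Kb ?tmul_Fb // !(BkE _ u_red uE) ?tmul_Fb //.
by rewrite -mulrA DtM.
Qed.

Lemma bar_mulEs i h : bar (h * Es i) = bar h * Es i.
Proof.
rewrite /Es !mulr_sumr bar_sum; apply: eq_bigr => x Fx.
by rewrite bar_mulDt ?hx_Fb.
Qed.

Lemma bar_Tw u : reduced u -> bar (Tw u) = Tiw u.
Proof.
move=> u_red; rewrite -[Tw u]mulr1 -(@Dt1 F m b Fb) -(TkE b _ u_red erefl)
  ?one_Fb //.
by rewrite bar_Tk ?in_Kb ?one_Fb // (BkE _ u_red erefl) ?one_Fb // Dt1 mulr1.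
Qed.

(** Torus elements pass T_s and its inverse with the same twist, so it suffices to treat T_w. At an
    ascent the reduced word grows; at a descent the quadratic relations of T_s and T_s^-1 correspond
    because bar c = - c. *)
Lemma bar_mulTs i h : bar (h * Ts i) = bar h * Tsi i.
Proof.
apply: bar_mulr => -[t d]; rewrite in_Kb => Fd.
suff [u [u_red uE barTT]] : exists u, [/\ reduced u, wperm u =
  t & bar (Tw u * Ts i) = Tiw u * Tsi i].
  rewrite (TkE b Fd u_red uE) (BkE Fd u_red uE) -!mulrA DtTs // DtTsi //.
  by rewrite !mulrA bar_mulDt ?tact_Fb // barTT.
have [t_i|t_i] := boolP (asc t i).
  have [u uE u_red] := reduced_word t; exists u; split=> //.
  by rewrite -Tw_rcons -Tiw_rcons bar_Tw // reduced_rcons u_red uE.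
have [u uE u_red] := reduced_word (st i * t)%g.
have [ui_red uiE] := reduced_rcons_desc t_i u_red uE.
exists (rcons u i); split=> //; rewrite Tw_rcons -mulrA Ts_quad mulrDr mulr1
  -TsEs //.
rewrite -(hecke_scaleAr c) mulrA bar_add bar_scale bar_mulEs -Tw_rcons !bar_Tw
  //.
rewrite Abar_KLc Tiw_rcons -[RHS]mulrA Tsi_quad [Tiw u * (1 - _)]mulrBr mulr1
  -(hecke_scaleAr c).
by rewrite (mulrA (Tiw u)) scaleNr.
Qed.

Lemma bar_Tiw u : bar (Tiw u) = Tw u.
Proof.
elim/last_ind: u => [|u i IHu].
  by have := @bar_Tw [::]; rewrite /Tiw /Tw !big_nil; apply;
    rewrite /reduced ninv1.
rewrite Tiw_rcons mulrBr -(hecke_scaleAr c) bar_add -scaleNr (bar_scale (- c))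
  bar_mulTs bar_mulEs.
rewrite rmorphN /= Abar_KLc opprK IHu Tw_rcons mulrBr -(hecke_scaleAr c).
by rewrite subrK.
Qed.

Lemma barK : involutive bar.
Proof.
move=> h; rewrite (barE h) bar_sum [RHS]ev_expand.
(* By semilinearity only the basis matters, where bar sends T_w to the product of the inverses and
   back ([bar_Tiw]). *)
apply: eq_bigr => -[t d]; rewrite in_Kb => Fd;
  have [u uE u_red] := reduced_word t.
rewrite bar_scale AbarK (BkE Fd u_red uE) bar_mulDt //.
by rewrite bar_Tiw (TkE b Fd u_red uE).
Qed.

Definition ev_below N h := forall k : K, (N <= ninv k.1)%N -> ev h k = 0.

Lemma ev_below_mulTs N h i : ev_below N h -> ev_below N.+1 (h * Ts i).
Proof.
move=> hN [t d] /= lt_N; rewrite ev_Ts // !ffunE /= hN /=; last first.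
  have [/ninv_asc->|/ninv_desc tE] := boolP (asc t i);
    first exact: leqW (ltnW lt_N).
  by rewrite tE in lt_N.
rewrite big1 ?mulr0 ?scaler0 ?addr0 // => x _.
by rewrite hN // ltnW.
Qed.

Lemma ev_below_mulDt N h f : f \in onFb -> ev_below N h ->
  ev_below N (h * Dt f).
Proof. by move=> Ff hN [t d] /= le_N; rewrite ev_Dt // ffunE hN. Qed.

Lemma ev_belowD N g h : ev_below N g -> ev_below N h -> ev_below N (g + h).
Proof. by move=> gN hN k le_N; rewrite (evD hFb) ffunDE gN // hN // addr0. Qed.

Lemma ev_belowZ N r h : ev_below N h -> ev_below N (r *: h).
Proof. by move=> hN k le_N; rewrite (evZ hFb) ffunZE hN // mulr0. Qed.

Lemma ev_below_mulEs N h i : ev_below N h -> ev_below N (h * Es i).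
Proof.
move=> hN k le_N; rewrite mulr_sumr ev_sum sum_ffunE big1 // => x Fx.
by rewrite (ev_below_mulDt (hx_Fb hFb _ _ Fx) hN).
Qed.

(** Each factor T_s - c E_s differs from T_s by a term that does not raise the inversion number, so
    replacing T_s by its inverse changes only shorter terms. *)
Lemma ev_below_Tiw u : reduced u -> ev_below (size u) (Tiw u - Tw u).
Proof.
elim/last_ind: u => [_|u i IHu].
  rewrite /Tiw /Tw !big_nil subrr => k _; rewrite -(scale0r (0 : H)) (evZ hFb).
  by rewrite ffunZE mul0r.
rewrite reduced_rcons size_rcons => /andP[u_red _]; have {}IHu := IHu u_red.
rewrite Tiw_rcons Tw_rcons mulrBr addrAC -mulrBl -(hecke_scaleAr c) -scaleNr.
apply: ev_belowD; first exact: ev_below_mulTs.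
apply/ev_belowZ/ev_below_mulEs; rewrite -[Tiw u](subrK (Tw u)).
apply: ev_belowD => k lt_N; first by rewrite IHu // ltnW.
rewrite ev_Tw // ffunE; case: eqP lt_N => // -> /=.
by rewrite (eqP u_red) ltnn.
Qed.

Lemma bar_unitriangular :
  {in Kb &, forall k p, (ninv k.1 <= ninv p.1)%N ->
    ev (bar (Tk k)) p = (p == k)%:R}.
Proof.
move=> [t d] p; rewrite in_Kb => Fd Kp le_tp;
  have [u uE u_red] := reduced_word t.
rewrite bar_Tk ?in_Kb // (BkE Fd u_red uE) -[Tiw u](subrK (Tw u)) mulrDl (evD
  hFb).
rewrite ffunDE -(TkE b Fd u_red uE) ev_TkE ?in_Kb //.
rewrite (ev_below_mulDt Fd (ev_below_Tiw u_red)) ?add0r //.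
by rewrite -(eqP u_red) uE.
Qed.

Lemma heckeT_negP h : heckeT_neg h <-> {in Kb, forall k, Aneg (ev h k)}.
Proof.
split=> [[a [aneg ->]] k Kk|hneg].
  by rewrite sum_WHb ev_comb //; apply: aneg; rewrite WHbE imset_f.
exists (Defs.coord h); split=> [x|]; last first.
  by rewrite sum_WHb [LHS]ev_expand; apply: eq_bigr => k Kk; rewrite coord_gmon.
by rewrite WHbE => /imsetP[k Kk ->]; rewrite coord_gmon //; apply: hneg.
Qed.

End BarInvolution.

Theorem theorem5p1 (F : finFieldType) (q m a b : nat) (Fb : {group {unit F}})
    (hq : #|F| = q) (ha : (0 < a)%N) (hb : (0 < b)%N) (hcop : coprime a b)
    (hab : (a * b = q - 1)%N) (hFb : #|Fb| = b)
    (y : {'GL_m.+1[F]}) (hy : y \in WHb m Fb) :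
  exists! C : heckeT m b Fb,
    hbar C = C /\ heckeT_neg (C - Tx b Fb y).
Proof.
move: hy; rewrite WHbE => /imsetP[k Kk ->].
(* The abstract statement is applied to pairs instead of matrices, with coordinates [ev] and the
   inversion number as length. *)
have [||||||||C [[barC Cneg] Cuniq]] := @KL_exists_unique b (heckeT m b Fb) _ (Kmon m Fb)
  (@Tk F m b Fb) (@ev F m b Fb) (fun k => ninv k.1) (@hbar F m b Fb) _ _ _ _ _ _ _ _ k Kk.
- by move=> g h x; rewrite (evD hFb) ffunDE.
- by move=> r h x; rewrite (evZ hFb) ffunZE.
- exact: ev_TkE.
- exact: ev_expand.
- exact: bar_add.
- exact: bar_scale.
- exact: barK.
- exact: bar_unitriangular.
exists C; split=> [|C' [barC' /(heckeT_negP hFb) C'neg]].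
  by split=> //; apply/(heckeT_negP hFb).
exact: Cuniq.
Qed.
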